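(* Let $V$ be a vertex operator algebra whose Zhu's algebra $A(V)$ is semisimple. If $\lambda\in\mathcal{P}(V)$ satisfies the condition $(\lambda+\mathbb{Z}_+)\cap\mathcal{P}(V)=\emptyset$, then any admissible $V$-module of the form $M=\bigoplus_{n\in\mathbb{N}}M^{(\lambda+n)}$ is completely reducible.
   Context: $\mathbb{N}$ is the set of nonnegative integers and $\mathbb{Z}_+$ the set of positive integers. Let $V=(V,Y,\mathbf 1,\omega)$ be a vertex operator algebra over $\mathbb{C}$, $Y(a,z)=\sum_{n\in\mathbb{Z}}a(n)z^{-n-1}$, graded by eigenvalues of $L(0)=\omega(1)$; $\mathrm{wt}(a)$ denotes the $L(0)$-eigenvalue of a homogeneous $a$. A weak $V$-module is a vector space $M$ with a linear map $Y_M:V\to(\mathrm{End}\,M)[[z,z^{-1}]]$, $Y_M(a,z)=\sum_{n\in\mathbb{Z}}a(n)z^{-n-1}$, such that $Y_M(a,z)u\in M((z))$ for $a\in V$, $u\in M$, $Y_M(\mathbf 1,z)=\mathrm{id}_M$, and the Jacobi identity $z_0^{-1}\delta(\frac{z_1-z_2}{z_0})Y_M(a,z_1)Y_M(b,z_2)-z_0^{-1}\delta(\frac{z_2-z_1}{-z_0})Y_M(b,z_2)Y_M(a,z_1)=z_2^{-1}\delta(\frac{z_1-z_0}{z_2})Y_M(Y(a,z_0)b,z_2)$ holds. Write $Y_M(\omega,z)=\sum_nL(n)z^{-n-2}$. An admissible $V$-module is a weak $V$-module with an $\mathbb{N}$-grading $M=\bigoplus_{n=0}^\infty M_n$ such that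 $a(n)M_m\subset M_{\mathrm{wt}(a)+m-n-1}$ for homogeneous $a$ ($M_m=0$ for $m<0$). Its degree operator $d$ acts on $M_n$ by $n$. An admissible submodule is a subspace stable under all $a(n)$ and under $d$. An admissible module is irreducible if it is nonzero and its only admissible submodules are $0$ and itself; it is completely reducible if it is a direct sum of irreducible admissible submodules. Zhu's algebra: for homogeneous $a\in V$ and $b\in V$ put $a\circ b=\mathrm{Res}_z\frac{(1+z)^{\mathrm{wt}(a)}}{z^2}Y(a,z)b$ and $a*b=\mathrm{Res}_z\frac{(1+z)^{\mathrm{wt}(a)}}{z}Y(a,z)b$ (extended linearly in $a$); $O(V)$ is the span of all $a\circ b$ and $A(V)=V/O(V)$, an associative algebra under $*$. For an irreducible admissible $V$-module $M$ there is $\lambda\in\mathbb{C}$ with $M=\bigoplus_{n=0}^\infty M(\lambda+n)$, where $M(\lambda+n)$ is the $L(0)$-eigenspace of eigenvalue $\lambda+n$ and $M(\lambda)\ne0$; $\lambda$ is called the lowest weight of $M$. $\mathcal{P}(V)$ is the set of lowest weights of all irreducible admissible $V$-modules. For a weak $V$-module $M$ and $\lambda\in\mathbb{C}$, $M^{(\lambda)}=\{u\in M\mid (L(0)-\lambda)^ku=0\text{ for some }k\in\mathbb{N}\}$. *)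

(* Defs.v *)
From HB Require Import structures.
From mathcomp Require Import all_boot all_order all_algebra.
From mathcomp Require Import generic_quotient ring_quotient.
From mathcomp Require Import complex.
From mathcomp Require Import boolp classical_sets functions cardinality fsbigop.
From mathcomp Require Import reals.

Set Implicit Arguments.
Unset Strict Implicit.
Unset Printing Implicit Defensive.

Import GRing.Theory Num.Theory.
Local Open Scope classical_set_scope.
Local Open Scope ring_scope.
Local Open Scope complex_scope.

(* Throughout, the sum of F i over (i \in setT) is a sum with finite support.
   It is only used where the truncation axioms, or an explicit finiteness
   hypothesis, make the support finite. *)

Definition subspace (K : nzRingType) (M : lmodType K) (U : set M) : Prop :=
  U 0 /\ forall (c : K) (u v : M), U u -> U v -> U (c *: u + v).

Definition span (K : nzRingType) (M : lmodType K) (S : set M) : set M :=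
  [set v | forall U : set M, subspace U -> S `<=` U -> U v].

Definition finite_dimensional (K : nzRingType) (M : lmodType K) (U : set M) :
  Prop :=
  exists s : seq M, U = span [set` s].

Definition decomposes (K : nzRingType) (M : lmodType K) (I : choiceType)
    (U : I -> set M) (v : M) (f : I -> M) : Prop :=
  [/\ forall i, U i (f i),
      finite_set [set i | f i <> 0]
    & v = \sum_(i \in [set: I]) f i].

Definition direct_sum (K : nzRingType) (M : lmodType K) (I : choiceType)
    (U : I -> set M) : Prop :=
  (forall i, subspace (U i)) /\ forall v, exists! f, decomposes U v f.

Definition components (K : nzRingType) (M : lmodType K) (I : choiceType)
    (U : I -> set M) (v : M) : I -> M :=
  xget (fun=> 0) [set f | decomposes U v f].

Section Quotient.
Context {K : nzRingType} {M : lmodType K} (S : set M).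

Lemma span_subspace : subspace (span S).
Proof.
split=> [U [U0 _] _ //|c u v Su Sv U sU SU].
by apply: sU.2; [exact: Su | exact: Sv].
Qed.

Definition span_pred : {pred M} := fun v => `[< span S v >].

Lemma span_zmod_closed : zmod_closed span_pred.
Proof.
have [S0 SD] := span_subspace; split; first exact/asboolP.
move=> u v /asboolP Su /asboolP Sv; apply/asboolP.
by rewrite addrC -scaleN1r; exact: SD.
Qed.

HB.instance Definition _ := GRing.isZmodClosed.Build M span_pred
  span_zmod_closed.

Definition quotient_space : Type := Quotient.quot span_pred.

HB.instance Definition _ := GRing.Zmodule.on quotient_space.

Definition quotient_proj (v : M) : quotient_space :=
  (\pi_(Quotient.quot span_pred) v)%qT.

Definition quotient_repr (x : quotient_space) : M :=
  repr (x : Quotient.quot span_pred).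

Lemma quotient_reprK : cancel quotient_repr quotient_proj.
Proof. exact: reprK. Qed.

Lemma quotient_projP (u v : M) :
  quotient_proj u = quotient_proj v <-> span S (u - v).
Proof.
rewrite /quotient_proj; split=> [/eqP|Suv].
  by rewrite -Quotient.idealrBE => /asboolP.
by apply/eqP; rewrite -Quotient.idealrBE; exact/asboolP.
Qed.

Lemma quotient_projD : {morph quotient_proj : u v / u + v}.
Proof. by move=> u v; rewrite /quotient_proj; exact: raddfD. Qed.

Definition quotient_scale (c : K) (x : quotient_space) : quotient_space :=
  quotient_proj (c *: quotient_repr x).

Lemma quotient_projZ (c : K) (v : M) :
  quotient_scale c (quotient_proj v) = quotient_proj (c *: v).
Proof.
apply/quotient_projP; rewrite -scalerBr -[X in span _ X]addr0.
have [S0 SD] := span_subspace; apply: SD => //.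
by apply/quotient_projP; rewrite quotient_reprK.
Qed.

Lemma quotient_scaleA (b c : K) (x : quotient_space) :
  quotient_scale b (quotient_scale c x) = quotient_scale (b * c) x.
Proof. by rewrite -[x]quotient_reprK !quotient_projZ scalerA. Qed.

Lemma quotient_scale1 : left_id 1 quotient_scale.
Proof. by move=> x; rewrite -[x]quotient_reprK quotient_projZ scale1r. Qed.

Lemma quotient_scaleDr : right_distributive quotient_scale +%R.
Proof.
move=> c x y; rewrite -[x]quotient_reprK -[y]quotient_reprK.
by rewrite -quotient_projD !quotient_projZ -quotient_projD scalerDr.
Qed.

Lemma quotient_scaleDl (x : quotient_space) :
  {morph quotient_scale^~ x : b c / b + c}.
Proof.
move=> b c; rewrite -[x]quotient_reprK !quotient_projZ.
by rewrite -quotient_projD scalerDl.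
Qed.

HB.instance Definition _ := GRing.Zmodule_isLmodule.Build K quotient_space
  quotient_scaleA quotient_scale1 quotient_scaleDr quotient_scaleDl.

End Quotient.

(* The following notions are meant for a unital associative algebra (A, mul);
   its left ideals are then automatically subspaces. *)
Definition left_ideal (K : nzRingType) (A : lmodType K) (mul : A -> A -> A)
    (J : set A) : Prop :=
  subspace J /\ forall a x, J x -> J (mul a x).

Definition minimal_left_ideal (K : nzRingType) (A : lmodType K)
    (mul : A -> A -> A) (J : set A) : Prop :=
  [/\ left_ideal mul J, J <> [set 0]
    & forall J', left_ideal mul J' -> J' `<=` J -> J' = [set 0] \/ J' = J].

(* A is semisimple as a left module over itself. *)
Definition semisimple_algebra (K : nzRingType) (A : lmodType K)
    (mul : A -> A -> A) : Prop :=
  exists (I : choiceType) (J : I -> set A),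
    (forall i, minimal_left_ideal mul (J i)) /\ direct_sum J.

(* The binomial coefficient of m over i, for m an integer of any sign: the
   coefficient of z ^ i in (1 + z) ^ m. *)
Definition binz (K : fieldType) (m : int) (i : nat) : K :=
  (\prod_(k < i) (m - k%:Z)%:~R) / (i`!)%:R.

Section FormalVertexOperators.
Context {K : fieldType} {V M : lmodType K}.

(* A map into (End M)[[z, z^-1]] is given by its modes: YM a n is a(n), the
   coefficient of z ^ (- n - 1) in YM(a, z). *)
Implicit Type YM : V -> int -> M -> M.

Definition bilinear_modes YM : Prop :=
  (forall n u, linear (fun a => YM a n u)) /\ (forall a n, linear (YM a n)).

(* YM(a, z) u belongs to M((z)). *)
Definition truncation YM : Prop :=
  forall a u, exists N : int, forall n, N <= n -> YM a n u = 0.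

Definition vacuum_identity (vac : V) YM : Prop :=
  forall n u, YM vac n u = if n == -1 then u else 0.

(* The Jacobi identity applied to u: coefficient of
   z0 ^ (- l - 1) z1 ^ (- m - 1) z2 ^ (- n - 1).  On the right-hand side
   delta((z1 - z0) / z2) / z2 contributes (-1) ^ i binz (i - m - 1) i, that is,
   binz m i. *)
Definition jacobi_identity (Y : V -> int -> V -> V) YM : Prop :=
  forall (a b : V) (u : M) (l m n : int),
    \sum_(i \in [set: nat])
       ((-1) ^+ i * binz K l i) *: YM a (l + m - i%:Z) (YM b (n + i%:Z) u)
    - \sum_(i \in [set: nat])
       ((-1) ^ l * (-1) ^+ i * binz K l i)
         *: YM b (l + n - i%:Z) (YM a (m + i%:Z) u)
    = \sum_(i \in [set: nat])
       binz K m i *: YM (Y a (l + i%:Z) b) (m + n - i%:Z) u.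

(* The mode L(n) of YM(omega, z), whose expansion has exponents - n - 2. *)
Definition virasoro_mode (omega : V) YM (n : int) : M -> M := YM omega (n + 1).

Definition virasoro_relations (L : int -> M -> M) (c : K) : Prop :=
  forall (m n : int) (u : M),
    L m (L n u) - L n (L m u)
    = (m - n)%:~R *: L (m + n) u
      + (if m + n == 0 then ((m ^+ 3 - m)%:~R / 12%:R * c) *: u else 0).

Definition eigenspace_of (T : M -> M) (lambda : K) : set M :=
  [set u | T u = lambda *: u].

End FormalVertexOperators.

Record vertex_operator_algebra (R : realType) := VertexOperatorAlgebra {
  voa_sort :> lmodType R[i];
  voa_Y : voa_sort -> int -> voa_sort -> voa_sort;
  voa_vac : voa_sort;
  voa_omega : voa_sort;
  voa_bilinear : bilinear_modes voa_Y;
  voa_truncation : truncation voa_Y;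
  voa_vacuum : vacuum_identity voa_vac voa_Y;
  voa_creation : forall a (n : int), - 1 <= n ->
    voa_Y a n voa_vac = if n == -1 then a else 0;
  voa_jacobi : jacobi_identity voa_Y voa_Y;
  voa_virasoro : exists c : R[i],
    virasoro_relations (virasoro_mode voa_omega voa_Y) c;
  voa_translation : forall a (n : int) u,
    voa_Y (virasoro_mode voa_omega voa_Y (-1) a) n u
    = - n%:~R *: voa_Y a (n - 1) u;
  voa_grading : direct_sum (fun n : int =>
    eigenspace_of (virasoro_mode voa_omega voa_Y 0) n%:~R);
  voa_grading_finite : forall n : int, finite_dimensional
    (eigenspace_of (virasoro_mode voa_omega voa_Y 0) n%:~R);
  voa_grading_bounded : exists N : int, forall n : int, n < N ->
    eigenspace_of (virasoro_mode voa_omega voa_Y 0) n%:~R = [set 0]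
}.

Definition voa_wt (R : realType) (V : vertex_operator_algebra R) (n : int) :
    set V :=
  eigenspace_of (virasoro_mode (voa_omega V) (@voa_Y R V) 0) n%:~R.

Record weak_module (R : realType) (V : vertex_operator_algebra R) :=
  WeakModule {
  wm_sort :> lmodType R[i];
  wm_Y : V -> int -> wm_sort -> wm_sort;
  wm_bilinear : bilinear_modes wm_Y;
  wm_truncation : truncation wm_Y;
  wm_vacuum : vacuum_identity (voa_vac V) wm_Y;
  wm_jacobi : jacobi_identity (@voa_Y R V) wm_Y
}.

Definition module_L (R : realType) (V : vertex_operator_algebra R)
    (M : weak_module V) : int -> M -> M :=
  virasoro_mode (voa_omega V) (@wm_Y R V M).
Arguments module_L {R V} M.

Definition int_grading (K : nzRingType) (M : lmodType K) (gr : nat -> set M)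
    (k : int) : set M :=
  if k is Posz n then gr n else [set 0].

Record admissible_module (R : realType) (V : vertex_operator_algebra R) :=
  AdmissibleModule {
  am_sort :> weak_module V;
  am_gr : nat -> set am_sort;
  am_grading : direct_sum am_gr;
  am_graded_action : forall (k : int) (a : V), voa_wt k a ->
    forall (n : int) (m : nat) (u : am_sort), am_gr m u ->
      int_grading am_gr (k + m%:Z - n - 1) (wm_Y a n u)
}.

Section AdmissibleModules.
Context {R : realType} {V : vertex_operator_algebra R}.

Definition degree_operator (M : admissible_module V) (u : M) : M :=
  \sum_(n \in [set: nat]) n%:R *: components (@am_gr R V M) u n.

Definition admissible_submodule (M : admissible_module V) (N : set M) : Prop :=
  [/\ subspace N,
      forall (a : V) (n : int) (u : M), N u -> N (wm_Y a n u)
    & forall u : M, N u -> N (degree_operator u)].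

(* The admissible submodules of N are those of M contained in N. *)
Definition irreducible_submodule (M : admissible_module V) (N : set M) :
    Prop :=
  [/\ admissible_submodule N, N <> [set 0]
    & forall N' : set M, admissible_submodule N' -> N' `<=` N ->
        N' = [set 0] \/ N' = N].

Definition irreducible_module (M : admissible_module V) : Prop :=
  irreducible_submodule [set: M].

Definition completely_reducible (M : admissible_module V) : Prop :=
  exists (I : choiceType) (N : I -> set M),
    (forall i, irreducible_submodule (N i)) /\ direct_sum N.

Definition lowest_weight (M : admissible_module V) (lambda : R[i]) : Prop :=
  direct_sum (fun n : nat => eigenspace_of (module_L M 0) (lambda + n%:R)) /\
  eigenspace_of (module_L M 0) lambda <> [set 0].

Definition generalized_eigenspace (M : weak_module V) (lambda : R[i]) :
    set M :=
  [set u | exists k : nat,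
     iter k (fun w => module_L M 0 w - lambda *: w) u = 0].

End AdmissibleModules.
Arguments generalized_eigenspace {R V} M lambda.

Definition lowest_weights (R : realType) (V : vertex_operator_algebra R) :
    set R[i] :=
  [set lambda | exists M : admissible_module V,
     irreducible_module M /\ lowest_weight M lambda].

Section ZhuAlgebra.
Context {R : realType} (V : vertex_operator_algebra R).

(* Res_z of (1 + z) ^ wt(a) z ^ k Y(a, z) b, extended linearly in a. *)
Definition zhu_residue (k : int) (a b : V) : V :=
  \sum_(n \in [set: int]) \sum_(i \in [set: nat])
     binz R[i] n i *: voa_Y (components (@voa_wt R V) a n) (k + i%:Z) b.

Definition zhu_circ : V -> V -> V := zhu_residue (-2).
Definition zhu_star : V -> V -> V := zhu_residue (-1).

(* The quotient of V by O(V), the span of all zhu_circ a b. *)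
Definition zhu_algebra : lmodType R[i] :=
  quotient_space [set x : V | exists a b : V, x = zhu_circ a b].

(* The choice of representatives is immaterial, O(V) being a two-sided ideal
   for zhu_star (Zhu). *)
Definition zhu_mul (x y : zhu_algebra) : zhu_algebra :=
  quotient_proj _ (zhu_star (quotient_repr x) (quotient_repr y)).

End ZhuAlgebra.

(* Main.v *)
From HB Require Import structures.
From mathcomp Require Import all_boot all_order all_algebra.
From mathcomp Require Import complex boolp classical_sets.
From mathcomp Require Import cardinality fsbigop reals zify.
Require Import Defs.

Set Implicit Arguments.
Unset Strict Implicit.
Unset Printing Implicit Defensive.

Import GRing.Theory Num.Theory.
Local Open Scope classical_set_scope.
Local Open Scope ring_scope.
Local Open Scope complex_scope.

(** Let lowest be the generalized L(0)-eigenspace of M for lambda.  Operators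
    of negative weight kill it, since M has no weights below lambda.  Two facts
    about it give the theorem.

    First, lowest controls submodules ([weak_submodule_lowest]): if S and N are
    submodules and the part of S in lowest lies in N, then S lies in N.
    Otherwise S contains a vector u outside N that is an L(0)-eigenvector
    modulo N, of some weight lambda + n; take n minimal.  If n = 0, then u is
    congruent modulo N to a vector of S in lowest, which is absurd.  If n > 0,
    all operators of negative weight send u into N, by minimality.  A largest
    submodule T containing N but not u (Zorn) makes the submodule of M/T
    generated by u irreducible of lowest weight lambda + n
    ([lowest_weight_of_singular]), against the hypothesis on lambda + Z_+.

    Second, lowest is completely reducible under the zero modes
    o(a) = a(wt a - 1).  On a vector killed by all operators of negative weight
    the Jacobi identity reduces to o(a o b) = 0 and o(a * b) = o(a) o(b), so
    the zero modes represent A(V) ([zero_mode_circ], [zero_mode_star]).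
    Decomposing 1 along the minimal left ideals of A(V) writes each vector as a
    sum of vectors in minimal o-stable subspaces
    ([singular_completely_reducible]).

    Let W be such a minimal subspace, inside one degree of the given grading
    of M.  By associativity the submodule generated by W is spanned by the
    a(n) w, so it meets lowest in W.  A nonzero submodule of it meets lowest by
    the first fact, hence contains W by minimality: it is irreducible
    ([mode_span_irreducible]).  The sum of all irreducible submodules contains
    lowest, so it is M, again by the first fact, and a sum of simple
    submodules is a direct sum of some of them ([direct_sum_of_simples]). *)

(** * Finitely supported sums, subspaces and direct sums *)

Section FiniteSums.
Context {I : choiceType} {V : zmodType}.
Implicit Types (s : seq I) (F : I -> V).

Lemma fsum_seq s F : uniq s -> (forall i, F i <> 0 -> i \in s) ->
  \sum_(i \in [set: I]) F i = \sum_(i <- s) F i.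
Proof.
move=> us sF; rewrite (fsbigE s) //; first by under eq_bigl do rewrite in_setT.
by move=> i _ /negP nis; apply: contrapT => /sF.
Qed.

Lemma fsum_single i0 F : (forall i, i != i0 -> F i = 0) ->
  \sum_(i \in [set: I]) F i = F i0.
Proof.
move=> F0; rewrite (@fsum_seq [:: i0]) ?big_seq1 // => i Fi.
by rewrite inE; case: eqP => // /eqP /F0.
Qed.

Lemma finite_support_seq F : finite_set [set i | F i <> 0] ->
  exists2 s, uniq s & forall i, F i <> 0 -> i \in s.
Proof.
move=> /finite_seqP[s sE]; exists (undup s); rewrite ?undup_uniq// => i Fi.
by rewrite mem_undup; have: [set i | F i <> 0] i by []; rewrite sE.
Qed.

Lemma seq_finite_support s F : (forall i, F i <> 0 -> i \in s) ->
  finite_set [set i | F i <> 0].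
Proof. by move=> sF; apply: sub_finite_set (finite_seq s) => i /= /sF. Qed.

End FiniteSums.

Lemma fsum_nat (V : zmodType) (F : nat -> V) (n : nat) :
  (forall i, (n <= i)%N -> F i = 0) ->
  \sum_(i \in [set: nat]) F i = \sum_(i < n) F i.
Proof.
move=> F0; rewrite (@fsum_seq _ _ (iota 0 n)) ?iota_uniq //.
  by rewrite -[X in iota _ X]subn0 -/(index_iota 0 n) big_mkord.
move=> i Fi; rewrite mem_iota add0n /=; case: ltnP => // /F0; by move/Fi.
Qed.

Section LinearFunctions.
Context {K : nzRingType} {M M' : lmodType K} (f : M -> M').
Hypothesis fl : linear f.

Lemma linear_D u v : f (u + v) = f u + f v.
Proof. by have := fl 1 u v; rewrite !scale1r. Qed.

Lemma linear_0 : f 0 = 0.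
Proof. by apply: (addrI (f 0)); rewrite -linear_D !addr0. Qed.

Lemma linear_Z c u : f (c *: u) = c *: f u.
Proof. by have := fl c u 0; rewrite !addr0 linear_0 addr0. Qed.

Lemma linear_N u : f (- u) = - f u.
Proof. by rewrite -scaleN1r linear_Z scaleN1r. Qed.

Lemma linear_B u v : f (u - v) = f u - f v.
Proof. by rewrite linear_D linear_N. Qed.

Lemma linear_big_sum (I : Type) (s : seq I) (F : I -> M) :
  f (\sum_(i <- s) F i) = \sum_(i <- s) f (F i).
Proof. exact: (big_morph f linear_D linear_0). Qed.

Lemma linear_fsum (I : choiceType) (F : I -> M) :
  finite_set [set i | F i <> 0] ->
  f (\sum_(i \in [set: I]) F i) = \sum_(i \in [set: I]) f (F i).
Proof.
move=> /finite_support_seq[s us sF].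
rewrite (fsum_seq us sF) (@fsum_seq _ _ s) ?linear_big_sum // => i fFi.
by apply: sF => Fi; apply: fFi; rewrite Fi linear_0.
Qed.

End LinearFunctions.

Section Subspaces.
Context {K : nzRingType} {M : lmodType K} (U : set M).
Hypothesis sU : subspace U.

Lemma subspace_0 : U 0. Proof. exact: sU.1. Qed.

Lemma subspaceZ c u : U u -> U (c *: u).
Proof.
by move=> Uu; rewrite -[X in U X]addr0; apply: sU.2 => //; exact: sU.1.
Qed.

Lemma subspaceD u v : U u -> U v -> U (u + v).
Proof. by move=> Uu Uv; rewrite -[u]scale1r; exact: sU.2. Qed.

Lemma subspaceN u : U u -> U (- u).
Proof. by move=> Uu; rewrite -scaleN1r; exact: subspaceZ. Qed.

Lemma subspaceB u v : U u -> U v -> U (u - v).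
Proof. by move=> Uu Uv; apply: subspaceD => //; exact: subspaceN. Qed.

Lemma subspace_sum (I : eqType) (s : seq I) (F : I -> M) :
  (forall i, i \in s -> U (F i)) -> U (\sum_(i <- s) F i).
Proof.
move=> UF; rewrite big_seq; apply: big_ind => //; first exact: subspace_0.
exact: subspaceD.
Qed.

Lemma subspace_fsum (I : choiceType) (A : set I) (F : I -> M) :
  (forall i, U (F i)) -> U (\sum_(i \in A) F i).
Proof.
move=> UF; apply: big_ind => // ; [exact: subspace_0|exact: subspaceD].
Qed.

End Subspaces.

Section SubspaceConstructions.
Context {K : nzRingType} {M : lmodType K}.

Lemma sub_span (S : set M) : S `<=` span S.
Proof. by move=> v Sv U _; apply. Qed.

Lemma subspace_preimage (M' : lmodType K) (f : M -> M') (U : set M') :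
  linear f -> subspace U -> subspace (f @^-1` U).
Proof.
move=> fl sU; split; first by rewrite /preimage /= linear_0 //; exact: sU.1.
by move=> c u v Uu Uv; rewrite /preimage /= fl; exact: sU.2.
Qed.

Lemma subspace_set0 : subspace [set (0 : M)].
Proof. by split=> // c u v -> ->; rewrite scaler0 addr0. Qed.

Lemma subspaceI (U W : set M) :
  subspace U -> subspace W -> subspace (U `&` W).
Proof.
move=> sU sW; split; first by split; [exact: sU.1|exact: sW.1].
by move=> c u v [? ?] [? ?]; split; [exact: sU.2|exact: sW.2].
Qed.

Lemma neq_set0P (U : set M) : subspace U -> U <> [set 0] ->
  exists2 u, U u & u <> 0.
Proof.
move=> sU U0; apply: contrapT => nU; apply: U0; apply/seteqP; split=> u /=.
  by move=> Uu; apply: contrapT => u0; apply: nU; exists u.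
by move=> ->; exact: subspace_0.
Qed.

End SubspaceConstructions.

Lemma subspace_eigenspace (K : fieldType) (M : lmodType K) (T : M -> M)
  (c : K) : linear T -> subspace (eigenspace_of T c).
Proof.
move=> Tl; split; first by rewrite /eigenspace_of /= linear_0 // scaler0.
move=> a u v Tu Tv; rewrite /eigenspace_of /= Tl Tu Tv scalerDr.
by rewrite !scalerA mulrC.
Qed.

Section DirectSums.
Context {K : nzRingType} {M : lmodType K} {I : choiceType}.
Variable U : I -> set M.

Lemma decomposes_lin c u v f g : (forall i, subspace (U i)) ->
  decomposes U u f -> decomposes U v g ->
  decomposes U (c *: u + v) (fun i => c *: f i + g i).
Proof.
move=> sU [Uf fin_f uE] [Ug fin_g vE].
have [s us sf] := finite_support_seq fin_f.
have [t ut tg] := finite_support_seq fin_g.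
have st i : f i <> 0 \/ g i <> 0 -> i \in undup (s ++ t).
  by rewrite mem_undup mem_cat => -[/sf ->|/tg ->] //; rewrite orbT.
have stfg i : c *: f i + g i <> 0 -> i \in undup (s ++ t).
  move=> fg0; apply: st; apply: contrapT => /not_orP[/contrapT f0 /contrapT g0].
  by apply: fg0; rewrite f0 g0 scaler0 addr0.
split; first by move=> i; exact: (sU i).2.
  exact: seq_finite_support stfg.
rewrite (fsum_seq (undup_uniq _) stfg) uE vE.
rewrite [X in c *: X](fsum_seq (undup_uniq (s ++ t))); last first.
  by move=> i ?; apply: st; left.
rewrite [X in _ + X](fsum_seq (undup_uniq (s ++ t))); last first.
  by move=> i ?; apply: st; right.
by rewrite big_split /= scaler_sumr.
Qed.

Lemma decomposes_homogeneous i v : (forall i, subspace (U i)) -> U i v ->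
  decomposes U v (fun j => if j == i then v else 0).
Proof.
move=> sU Uv; have sup j : (if j == i then v else 0) <> 0 -> j \in [:: i].
  by rewrite inE; case: eqP.
split.
- by move=> j; case: eqP => [->//|_]; exact: subspace_0.
- exact: seq_finite_support sup.
- by rewrite (fsum_seq _ sup)// big_seq1 eqxx.
Qed.

Lemma direct_sum_of_independent : (forall i, subspace (U i)) ->
  (forall W : set M, subspace W -> (forall i, U i `<=` W) -> forall v, W v) ->
  (forall (s : seq I) f, uniq s -> (forall i, U i (f i)) ->
     \sum_(i <- s) f i = 0 -> forall i, i \in s -> f i = 0) ->
  direct_sum U.
Proof.
move=> sU spU indU; split=> // v.
have [f vf] : [set v | exists f, decomposes U v f] v.
  apply: spU => [|i u Uu].
    split=> [|c u w [f uf] [g wg]].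
      exists (fun=> 0); split; first by move=> i; exact: subspace_0.
        exact: (@seq_finite_support _ _ [::]).
      by rewrite fsbig1.
    by exists (fun i => c *: f i + g i); exact: decomposes_lin.
  by exists (fun j => if j == i then u else 0); exact: decomposes_homogeneous.
exists f; split=> // g vg; apply/funext => i.
have [Uh fin_h] := decomposes_lin (-1) sU vg vf.
rewrite scaleN1r addNr; have [s us sh] := finite_support_seq fin_h.
rewrite (fsum_seq us sh) => /esym hE.
suff : -1 *: g i + f i = 0.
  by rewrite scaleN1r addrC => /eqP; rewrite subr_eq0 => /eqP.
apply: contrapT => hi; exact: hi (indU s _ us Uh hE i (sh i hi)).
Qed.

Hypothesis dU : direct_sum U.

Lemma componentsP v : decomposes U v (components U v).
Proof.
rewrite /components; case: xgetP => [f -> //|].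
by have [f [vf _]] := dU.2 v; move=> /(_ f).
Qed.

Lemma components_eq v f : decomposes U v f -> components U v = f.
Proof.
have [g [vg gU]] := dU.2 v.
by move=> /gU <-; rewrite -(gU _ (componentsP v)).
Qed.

Lemma components_in v i : U i (components U v i).
Proof. by have [+ _ _] := componentsP v; apply. Qed.

Lemma components_linear i : linear (fun v => components U v i).
Proof.
move=> c u v.
rewrite (@components_eq (c *: u + v)
           (fun i => c *: components U u i + components U v i)) //.
by apply: decomposes_lin; [exact: dU.1|exact: componentsP|exact: componentsP].
Qed.

Lemma components_homogeneous i v : U i v ->
  components U v = fun j => if j == i then v else 0.
Proof.
move=> Uv; apply: components_eq; apply: decomposes_homogeneous => //.
exact: dU.1.
Qed.

Lemma direct_sum_ind (W : set M) : subspace W -> (forall i, U i `<=` W) ->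
  forall v, W v.
Proof.
move=> sW UW v; have [Uf _ ->] := componentsP v.
by apply: subspace_fsum => // i; apply: UW; exact: Uf.
Qed.

Lemma linear_ext (M' : lmodType K) (f g : M -> M') : linear f -> linear g ->
  (forall i v, U i v -> f v = g v) -> f =1 g.
Proof.
move=> fl gl fg; apply: direct_sum_ind fg.
split; first by rewrite /= !linear_0.
by move=> c u v /= fgu fgv; rewrite fl gl fgu fgv.
Qed.

(** Maps defined on homogeneous vectors and extended by linearity, such as the
    degree operator, Zhu's residues and the zero modes, all have this form. *)
Lemma fsum_components_linear (M' : lmodType K) (g : I -> M -> M') :
  (forall i, linear (g i)) ->
  linear (fun v => \sum_(i \in [set: I]) g i (components U v i)).
Proof.
move=> gl c u v.
have [_ /finite_support_seq[s us su] _] := componentsP u.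
have [_ /finite_support_seq[t ut tv] _] := componentsP v.
have st w i : w = u \/ w = v -> g i (components U w i) <> 0 ->
    i \in undup (s ++ t).
  move=> wuv gw; have w0 : components U w i <> 0.
    by move=> w0; apply: gw; rewrite w0 linear_0.
  rewrite mem_undup mem_cat.
  by case: wuv w0 => -> => [/su ->|/tv ->] //; rewrite orbT.
rewrite !(fsum_seq (undup_uniq (s ++ t))).
- rewrite scaler_sumr -big_split /=; apply: eq_bigr => i _.
  by rewrite components_linear gl.
- by move=> i; apply: st; right.
- by move=> i; apply: st; left.
move=> i; rewrite components_linear gl => uv0; apply: contrapT => nst.
have /contrapT u0 := contra_not (st u i (or_introl erefl)) nst.
have /contrapT v0 := contra_not (st v i (or_intror erefl)) nst.
by apply: uv0; rewrite u0 v0 scaler0 addr0.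
Qed.

Lemma fsum_components_homogeneous (M' : lmodType K) (g : I -> M -> M') i v :
  (forall i, g i 0 = 0) -> U i v ->
  \sum_(j \in [set: I]) g j (components U v j) = g i v.
Proof.
move=> g0 Uv; rewrite (components_homogeneous Uv) (@fsum_single _ _ i).
  by rewrite eqxx.
by move=> j /negPf ->.
Qed.

End DirectSums.

(** Applying T - c j to a vanishing sum of eigenvectors removes the j-th term
    and rescales the i-th one by c i - c j. *)
Lemma eigenspaces_independent (K : fieldType) (M : lmodType K) (T : M -> M)
    (I : eqType) (c : I -> K) (s : seq I) (f : I -> M) :
  linear T -> injective c -> uniq s ->
  (forall i, eigenspace_of T (c i) (f i)) ->
  \sum_(i <- s) f i = 0 -> forall i, i \in s -> f i = 0.
Proof.
move=> Tl ci; elim: s f => // j s IH f /= /andP[js us] Tf.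
rewrite big_cons => s0.
have f0 i : i \in s -> f i = 0.
  move=> is_.
  have sum0 : \sum_(i <- s) (c i - c j) *: f i = 0.
    have := congr1 T s0.
    rewrite (linear_0 Tl) (linear_D Tl) (linear_big_sum Tl) Tf.
    have /eqP := s0; rewrite addr_eq0 => /eqP ->.
    rewrite scalerN scaler_sumr -sumrN -big_split /= => TE; rewrite -[RHS]TE.
    by apply: eq_bigr => k _; rewrite Tf scalerBl addrC.
  have Tg k : eigenspace_of T (c k) ((c k - c j) *: f k).
    by rewrite /eigenspace_of /= (linear_Z Tl) Tf !scalerA mulrC.
  have /eqP := IH _ us Tg sum0 i is_; rewrite scaler_eq0 subr_eq0.
  case/orP => [/eqP /ci ij|/eqP//].
  by move: js; rewrite -ij is_.
move=> i; rewrite inE => /orP[/eqP ->|/f0//].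
move: s0; rewrite big_seq big1 => [|k /f0//].
by rewrite addr0.
Qed.


(** * Sums of simple submodules *)

(** The class of submodules enters only through its closure under sums and
    binary intersections, which is what the argument uses. *)
Section SemisimpleLattice.
Context {K : nzRingType} {M : lmodType K}.
Variable sub : set M -> Prop.
Hypothesis sub_subspace : forall X, sub X -> subspace X.
Hypothesis subI : forall X X', sub X -> sub X' -> sub (X `&` X').
Hypothesis sub_sum : forall F : set (set M), F `<=` sub ->
  sub (span (\bigcup_(X in F) X)).

Definition simple_sub (X : set M) : Prop :=
  [/\ sub X, X <> [set 0]
    & forall X', sub X' -> X' `<=` X -> X' = [set 0] \/ X' = X].

Definition independent_family (F : set (set M)) : Prop :=
  F `<=` simple_sub /\
  forall (s : seq (set M)) (f : set M -> M), uniq s ->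
    (forall X, X \in s -> F X /\ X (f X)) ->
    \sum_(X <- s) f X = 0 -> forall X, X \in s -> f X = 0.

Lemma maximal_independent_family :
  exists2 F, independent_family F &
    forall G, F `<` G -> ~ independent_family G.
Proof.
have [|F [iF Fmax]] := @Zorn_bigcup (set M) independent_family; last first.
  by exists F.
move=> C Cind Ctot; split=> [X [F /Cind[FS _] /FS]//|s f us sf s0].
(* only finitely many members are involved, so one member of the chain
   contains them all *)
have [s_nil|[F CF sF]] : s = [::] \/
    (exists2 F, C F & forall X, X \in s -> F X).
  have : forall X, X \in s -> exists2 F, C F & F X.
    by move=> X /sf[[F CF FX] _]; exists F.
  elim: s {us sf s0} => [|X s IH] sC; first by left.
  right; have [F CF FX] := sC X (mem_head _ _).
  case: IH => [Y Ys|->|[G CG sG]].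
  - by apply: sC; rewrite inE Ys orbT.
  - by exists F => // Y; rewrite inE => /eqP ->.
  - have [FG|GF] := Ctot F G CF CG.
      exists G => // Y; rewrite inE => /orP[/eqP ->|/sG//].
      exact: FG.
    exists F => // Y; rewrite inE => /orP[/eqP ->//|/sG].
    exact: GF.
  by rewrite s_nil.
have [_ indF] := Cind _ CF.
by apply: indF => // X Xs; split; [exact: sF|exact: (sf X Xs).2].
Qed.

(** A simple submodule that is not contained in the sum of the family meets
    this sum in a proper submodule, that is, in 0. *)
Lemma independent_family_add (F : set (set M)) (N : set M) :
  independent_family F -> simple_sub N -> ~ N `<=` span (\bigcup_(X in F) X) ->
  independent_family (F `|` [set N]).
Proof.
move=> [FS indF] Ns NF.
have [sN _ Nmin] := Ns.
split=> [X [/FS//|->//]|s f us sf s0].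
have N0 : N `&` span (\bigcup_(X in F) X) = [set 0].
  have [||//|NE] := Nmin (N `&` span (\bigcup_(X in F) X)).
  - by apply: subI => //; apply: sub_sum => X /FS[].
  - by move=> x [].
  by exfalso; apply: NF; rewrite -NE => x [].
have FX X : X \in s -> X <> N -> F X.
  by move=> /sf[[//|/= ->]].
case: (boolP (N \in s)) => [Nin|Nnin]; last first.
  apply: indF => // X Xs; split; last exact: (sf X Xs).2.
  by apply: FX => // XN; rewrite -XN Xs in Nnin.
have fN : f N = 0.
  suff : [set 0] (f N) by [].
  rewrite -N0; split; first exact: (sf N Nin).2.
  have /eqP := s0; rewrite (perm_big _ (perm_to_rem Nin)) big_cons addr_eq0.
  move=> /eqP ->; have sp := span_subspace (\bigcup_(X in F) X).
  apply: (subspaceN sp); apply: (subspace_sum sp) => X.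
  rewrite mem_rem_uniq // inE => /andP[/eqP XN Xs].
  apply: sub_span; exists X; [exact: FX|exact: (sf X Xs).2].
move=> X Xs; have [->//|XN] := pselect (X = N).
apply: (indF (rem N s)); rewrite ?rem_uniq //.
- move=> Y; rewrite mem_rem_uniq // inE => /andP[/eqP YN Ys].
  by split; [exact: FX|exact: (sf Y Ys).2].
- have := s0; rewrite (perm_big _ (perm_to_rem Nin)) big_cons /= fN add0r.
  exact.
- by rewrite mem_rem_uniq // inE Xs andbT; apply/eqP.
Qed.

(** The sum of a maximal independent family of simple submodules contains every
    simple submodule, as that submodule could be added to the family. *)
Theorem direct_sum_of_simples :
  (forall v, span (\bigcup_(X in simple_sub) X) v) ->
  exists (I : choiceType) (N : I -> set M),
    (forall i, simple_sub (N i)) /\ direct_sum N.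
Proof.
move=> spM; have [F iF Fmax] := maximal_independent_family.
have [FS indF] := iF.
have spF v : span (\bigcup_(X in F) X) v.
  apply: spM; first exact: span_subspace.
  move=> x [N Ns Nx]; apply: contrapT => nx.
  apply: (Fmax (F `|` [set N])); last first.
    by apply: independent_family_add => // /(_ x Nx).
  split=> [X FX|]; first by left.
  move=> NF; apply: nx; apply: sub_span; exists N => //.
  by apply: NF; right.
exists (set_type F), (fun X => val X); split=> [[X /= /set_mem/FS//]|].
apply: direct_sum_of_independent.
- by move=> [X /= /set_mem/FS[/sub_subspace]].
- move=> W sW FW v; apply: spF => // x [X FX Xx].
  exact: (FW (exist _ X (mem_set FX))).
move=> s f us sf s0 i is_.
pose g (X : set M) := if insub X is Some j then f j else 0.
have gE j : g (val j) = f j by rewrite /g valK.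
rewrite -gE; apply: (indF (map val s)).
- by rewrite map_inj_uniq //; exact: val_inj.
- move=> X /mapP[j js ->]; rewrite gE; split; last exact: sf.
  exact: set_mem (valP j).
- by rewrite big_map; under eq_bigr do rewrite gE.
- exact: map_f.
Qed.

End SemisimpleLattice.

(** * Weak modules *)

Section WeakModuleTheory.
Context {R : realType} {V : vertex_operator_algebra R}.

Lemma binz0 (K : fieldType) (m : int) : binz K m 0 = 1.
Proof. by rewrite /binz big_ord0 fact0 divr1. Qed.

Lemma binz1 (K : fieldType) (m : int) : binz K m 1 = m%:~R.
Proof. by rewrite /binz big_ord_recl big_ord0 /= subr0 mulr1 divr1. Qed.

Lemma binz_small (K : fieldType) (m i : nat) :
  (m < i)%N -> binz K m i = 0.
Proof.
move=> mi; rewrite /binz (bigD1 (Ordinal mi)) //= subrr.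
by rewrite mulr0z !mul0r.
Qed.

Lemma truncation_nat (W M : lmodType R[i]) (YM : W -> int -> M -> M) :
  truncation YM -> forall a u n, exists k : nat, forall i : nat, (k <= i)%N ->
    YM a (n + i%:Z) u = 0.
Proof.
move=> tr a u n; have [N aN] := tr a u.
exists `|N - n|%N => i ki; apply: aN; lia.
Qed.

Lemma nat_finite_support (M : zmodType) (F : nat -> M) (k : nat) :
  (forall i, (k <= i)%N -> F i = 0) -> finite_set [set i | F i <> 0].
Proof.
move=> F0; apply: (@seq_finite_support _ _ (iota 0 k)) => i Fi.
by rewrite mem_iota add0n /=; case: ltnP => // /F0 /Fi.
Qed.

(** The axioms of a weak module, separated from the record so that they can be
    transported to a bare vector space. *)
Definition module_axioms (M : lmodType R[i])
    (YM : V -> int -> M -> M) : Prop :=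
  [/\ bilinear_modes YM, truncation YM, vacuum_identity (voa_vac V) YM
    & jacobi_identity (@voa_Y R V) YM].

Definition jacobi_left (M : lmodType R[i]) (YM : V -> int -> M -> M)
    (a b : V) (u : M) (l m n : int) : M :=
  \sum_(i \in [set: nat])
     ((-1) ^+ i * binz R[i] l i) *: YM a (l + m - i%:Z) (YM b (n + i%:Z) u)
  - \sum_(i \in [set: nat])
     ((-1) ^ l * (-1) ^+ i * binz R[i] l i)
       *: YM b (l + n - i%:Z) (YM a (m + i%:Z) u).

Definition jacobi_right (M : lmodType R[i]) (YM : V -> int -> M -> M)
    (a b : V) (u : M) (l m n : int) : M :=
  \sum_(i \in [set: nat])
     binz R[i] m i *: YM (voa_Y a (l + i%:Z) b) (m + n - i%:Z) u.

Section Transport.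
Context {M M' : lmodType R[i]}.
Variables (YM : V -> int -> M -> M) (YM' : V -> int -> M' -> M').
Variable f : M -> M'.
Hypothesis fl : linear f.
Hypothesis fY : forall a n u, f (YM a n u) = YM' a n (f u).
Hypothesis YMl : bilinear_modes YM.
Hypothesis YMt : truncation YM.

Lemma map_double_sum (a b : V) u (k n : int) (c : nat -> R[i]) :
  f (\sum_(i \in [set: nat]) c i *: YM a (k - i%:Z) (YM b (n + i%:Z) u))
  = \sum_(i \in [set: nat]) c i *: YM' a (k - i%:Z) (YM' b (n + i%:Z) (f u)).
Proof.
have [N bN] := truncation_nat YMt b u n.
rewrite (linear_fsum fl) => [|].
  by apply: eq_fsbigr => i _; rewrite (linear_Z fl) !fY.
apply: (@nat_finite_support _ _ N) => i /bN ->.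
by rewrite (linear_0 (YMl.2 _ _)) scaler0.
Qed.

Lemma map_iterate_sum (a b : V) u (l k : int) (c : nat -> R[i]) :
  f (\sum_(i \in [set: nat]) c i *: YM (voa_Y a (l + i%:Z) b) (k - i%:Z) u)
  = \sum_(i \in [set: nat]) c i *: YM' (voa_Y a (l + i%:Z) b) (k - i%:Z) (f u).
Proof.
have [N aN] := truncation_nat (@voa_truncation R V) a b l.
rewrite (linear_fsum fl) => [|].
  by apply: eq_fsbigr => i _; rewrite (linear_Z fl) fY.
apply: (@nat_finite_support _ _ N) => i /aN ->.
by rewrite (linear_0 (YMl.1 _ _)) scaler0.
Qed.

Lemma map_jacobi_left (a b : V) u (l m n : int) :
  f (jacobi_left YM a b u l m n) = jacobi_left YM' a b (f u) l m n.
Proof.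
rewrite /jacobi_left (linear_B fl).
by congr (_ - _); exact: map_double_sum.
Qed.

Lemma map_jacobi_right (a b : V) u (l m n : int) :
  f (jacobi_right YM a b u l m n) = jacobi_right YM' a b (f u) l m n.
Proof. exact: map_iterate_sum. Qed.

End Transport.

Lemma module_axioms_image (M M' : lmodType R[i]) (YM : V -> int -> M -> M)
    (YM' : V -> int -> M' -> M') (f : M -> M') :
  linear f -> (forall a n u, f (YM a n u) = YM' a n (f u)) ->
  (forall v, exists u, f u = v) -> module_axioms YM -> module_axioms YM'.
Proof.
move=> fl fY fs [YMl YMt YMv YMj]; split.
- split=> [n v c a b|a n c v w].
    by have [u <-] := fs v; rewrite -!fY YMl.1 fl.
  by have [u <-] := fs v; have [x <-] := fs w; rewrite -fl -!fY YMl.2 fl.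
- move=> a v; have [u <-] := fs v; have [N aN] := YMt a u.
  by exists N => n /aN; rewrite -fY => ->; rewrite (linear_0 fl).
- move=> n v; have [u <-] := fs v; rewrite -fY YMv.
  by case: eqP => // _; rewrite (linear_0 fl).
- move=> a b v l m n; have [u <-] := fs v.
  have := congr1 f (YMj a b u l m n).
  rewrite -/(jacobi_left YM a b u l m n) -/(jacobi_right YM a b u l m n).
  by rewrite (map_jacobi_left fl fY YMl YMt) (map_jacobi_right fl fY YMl).
Qed.

Lemma module_axioms_sub (M M' : lmodType R[i]) (YM : V -> int -> M -> M)
    (YM' : V -> int -> M' -> M') (f : M' -> M) :
  linear f -> (forall a n u, f (YM' a n u) = YM a n (f u)) ->
  injective f -> module_axioms YM -> module_axioms YM'.
Proof.
move=> fl fY fi [YMl YMt YMv YMj].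
have YMl' : bilinear_modes YM'.
  split=> [n v c a b|a n c v w]; apply: fi.
    by rewrite fY YMl.1 fl !fY.
  by rewrite fY !fl YMl.2 !fY.
have YMt' : truncation YM'.
  move=> a v; have [N aN] := YMt a (f v); exists N => n /aN.
  by rewrite -fY -(linear_0 fl) => /fi.
split=> // [n v|a b v l m n]; apply: fi.
  by rewrite fY YMv; case: eqP => // _; rewrite (linear_0 fl).
rewrite -/(jacobi_left YM' a b v l m n) -/(jacobi_right YM' a b v l m n).
rewrite (map_jacobi_left fl fY YMl' YMt') (map_jacobi_right fl fY YMl').
exact: YMj.
Qed.

Definition adjoint_module : weak_module V :=
  WeakModule (voa_bilinear V) (@voa_truncation R V) (@voa_vacuum R V)
    (@voa_jacobi R V).

Section Modes.
Variable M : weak_module V.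
Implicit Types (a b : V) (u v w : M) (N W : set M) (m n p q l : int).

Definition weak_submodule N : Prop :=
  subspace N /\ forall a n u, N u -> N (wm_Y a n u).

Lemma modes_linear_vector a n : linear (@wm_Y R V M a n).
Proof. exact: (wm_bilinear M).2. Qed.

Lemma modes_linear_state n u : linear (fun a => wm_Y a n u).
Proof. exact: (wm_bilinear M).1. Qed.

(** The L(-1)-derivative property on modules, L(-1) b being b(-2) 1.  With the
    vacuum as second state, l = - 2 and n = - 1 in the Jacobi identity, the
    second product vanishes and only i = 0 survives in the first one; the
    iterates vanish for i > 1. *)
Lemma derivative_mode b n u :
  wm_Y (voa_Y b (-2) (voa_vac V)) n u = - n%:~R *: wm_Y b (n - 1) u.
Proof.
have := wm_jacobi b (voa_vac V) u (-2) (n + 1) (-1).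
rewrite (@fsum_single _ _ 0%N); last first.
  move=> i i0; rewrite wm_vacuum ifF; last by apply/negbTE; lia.
  by rewrite (linear_0 (modes_linear_vector _ _)) scaler0.
rewrite [X in _ - X](@fsum_single _ _ 0%N); last first.
  move=> i _; rewrite wm_vacuum ifF ?scaler0 //; last by apply/negbTE; lia.
rewrite (@fsum_nat _ _ 2); last first.
  move=> i i2; rewrite voa_creation ?ifF ?(linear_0 (modes_linear_state _ _)).
  - by rewrite scaler0.
  - by apply/negbTE; lia.
  - by lia.
rewrite !wm_vacuum /= scaler0 subr0 expr0 binz0 mul1r scale1r.
rewrite !big_ord_recl big_ord0 /= binz0 binz1 scale1r addr0.
rewrite !addr0 ?subr0 /bump addn0 /= (_ : -2 + 1%:Z = -1) //.
rewrite (_ : n + 1 - 1 = n); last lia.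
rewrite (@voa_creation _ _ b (-1)) //=.
rewrite (_ : -2 + (n + 1) = n - 1); last lia.
move=> /eqP; rewrite -subr_eq => /eqP <-.
rewrite intrD scalerDl scale1r opprD addrCA subrr addr0 -scaleNr.
by [].
Qed.

Lemma translation_state b : voa_Y (voa_omega V) 0 b = voa_Y b (-2) (voa_vac V).
Proof.
have := voa_translation b (-1) (voa_vac V).
rewrite voa_creation //= /virasoro_mode (_ : -1 + 1 = 0 :> int) //.
by rewrite mulrN1z opprK scale1r.
Qed.

Lemma L0_linear : linear (module_L M 0).
Proof. exact: modes_linear_vector. Qed.

(** The commutator formula, l = 0 and m = 1 in the Jacobi identity, reads
    [L(0), b(n)] = (L(-1) b)(n + 1) + (L(0) b)(n). *)
Lemma L0_mode p b n u : voa_wt p b ->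
  module_L M 0 (wm_Y b n u)
  = wm_Y b n (module_L M 0 u) + (p - n - 1)%:~R *: wm_Y b n u.
Proof.
move=> wt_b; rewrite /module_L /virasoro_mode add0r.
have := wm_jacobi (voa_omega V) b u 0 1 n.
rewrite (@fsum_single _ _ 0%N); last first.
  by move=> [//|i] _; rewrite (@binz_small _ 0) // mulr0 scale0r.
rewrite [X in _ - X](@fsum_single _ _ 0%N); last first.
  by move=> [//|i] _; rewrite (@binz_small _ 0) // mulr0 scale0r.
rewrite (@fsum_nat _ _ 2); last first.
  by move=> i i2; rewrite (@binz_small _ 1) // scale0r.
rewrite !big_ord_recl big_ord0 /= !binz0 binz1 !expr0 expr0z !mul1r !scale1r.
rewrite !add0r !addr0 ?subr0 /bump addn0 translation_state derivative_mode.
have -> : voa_Y (voa_omega V) 1 b = p%:~R *: b by exact: wt_b.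
rewrite (linear_Z (modes_linear_state _ _)).
move=> /eqP; rewrite subr_eq => /eqP ->.
rewrite addrC; congr (_ + _).
rewrite (_ : 1 + n - 1 = n) ; last lia.
by rewrite -scalerDl -intrN -intrD; congr (_%:~R *: _); lia.
Qed.

Lemma weak_submodule_L0 N u : weak_submodule N -> N u -> N (module_L M 0 u).
Proof. by move=> [_ +] Nu; apply. Qed.

Definition mode_span W : set M :=
  span [set v | exists a n w, W w /\ v = wm_Y a n w].

Lemma mode_in_mode_span W a n w : W w -> mode_span W (wm_Y a n w).
Proof. by move=> Ww; apply: sub_span; exists a, n, w. Qed.

Lemma sub_mode_span W : W `<=` mode_span W.
Proof.
move=> w Ww; have := wm_vacuum (-1) w; rewrite eqxx => <-.
exact: mode_in_mode_span.
Qed.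

Lemma mode_span_sub W N : weak_submodule N -> W `<=` N -> mode_span W `<=` N.
Proof.
move=> [sN NY] WN v; apply=> // x [a [n [w [Ww ->]]]].
by apply: NY; exact: WN.
Qed.

Lemma mode_span_ind W N : subspace N ->
  (forall p a n w, voa_wt p a -> W w -> N (wm_Y a n w)) -> mode_span W `<=` N.
Proof.
move=> sN NY v; apply=> // x [a [n [w [Ww ->]]]]; move: a.
apply: (direct_sum_ind (voa_grading V)).
  exact: (subspace_preimage (modes_linear_state n w) sN).
by move=> p a wt_a; exact: NY wt_a Ww.
Qed.

(** When z1-exponents are so large that a(A + i) w = 0, the second product in
    the Jacobi identity vanishes, and a(p) b(q) w is expressed through modes
    applied to w and products a(p - i) b(q + i) w with i > 0.  As b(q) w = 0
    for q large, descending induction on q applies. *)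
Lemma mode_mode_in_mode_span W a b p q w : W w ->
  mode_span W (wm_Y a p (wm_Y b q w)).
Proof.
move=> Ww; have sW : subspace (mode_span W) by exact: span_subspace.
have [A aw] := truncation_nat (@wm_truncation R V M) a w 0.
have [B bw] := truncation_nat (@wm_truncation R V M) b w 0.
suff H : forall k : nat, forall p q : int, B%:Z - k%:Z <= q ->
    mode_span W (wm_Y a p (wm_Y b q w)).
  by apply: (H `|B%:Z - q|%N); lia.
elim=> [|k IH] {}p {}q kq.
  rewrite (_ : q = 0 + `|q|%:Z); last by lia.
  rewrite bw; last by lia.
  by rewrite (linear_0 (modes_linear_vector _ _)); exact: subspace_0.
have := wm_jacobi a b w (p - A%:Z) A%:Z q.
rewrite [X in _ - X]fsbig1; last first.
  move=> i _; rewrite (_ : A%:Z + i%:Z = 0 + (A + i)%:Z) ?aw ?leq_addr//.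
  by rewrite (linear_0 (modes_linear_vector _ _)) scaler0.
rewrite subr0 (@fsum_nat _ _ (k.+1)) => [|i ki]; last first.
  rewrite (_ : q + i%:Z = 0 + `|q + i%:Z|%:Z); last by lia.
  rewrite bw; last by lia.
  by rewrite (linear_0 (modes_linear_vector _ _)) scaler0.
rewrite big_ord_recl /= expr0 binz0 mul1r scale1r addr0 subrK subr0.
move=> /eqP; rewrite eq_sym -subr_eq => /eqP <-.
apply: (subspaceB sW).
  apply: (subspace_fsum sW) => i; apply: (subspaceZ sW).
  exact: mode_in_mode_span.
apply: (subspace_sum sW) => i _; apply: (subspaceZ sW); apply: IH.
rewrite /bump; lia.
Qed.

Lemma mode_span_submodule W : weak_submodule (mode_span W).
Proof.
split=> [|a n v]; first exact: span_subspace.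
apply: (@mode_span_ind W (wm_Y a n @^-1` mode_span W)); last first.
  by move=> p b q w _; exact: mode_mode_in_mode_span.
exact: (subspace_preimage (modes_linear_vector a n) (span_subspace _)).
Qed.

End Modes.
End WeakModuleTheory.

(** * Products of shifted operators *)

Section ShiftedProducts.
Context {K : fieldType} {M : lmodType K} (T : M -> M).
Hypothesis Tl : linear T.
Implicit Types (c d : K) (s t : seq K) (u v : M) (N : set M).

Definition shift c v : M := T v - c *: v.

Definition shifts s v : M := foldr shift v s.

Lemma shift_linear c : linear (shift c).
Proof.
move=> a u v; rewrite /shift Tl scalerBr !scalerDr !scalerA opprD addrACA.
by rewrite [c * a]mulrC.
Qed.

Lemma shifts_linear s : linear (shifts s).
Proof. by elim: s => // c s IH a u v; rewrite /= IH shift_linear. Qed.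

Lemma shiftC c d v : shift c (shift d v) = shift d (shift c v).
Proof.
rewrite /shift !(linear_B Tl) !(linear_Z Tl) !scalerBr !scalerA.
rewrite [c * d]mulrC !opprB addrACA [in RHS]addrACA.
by congr (_ + _); rewrite addrC.
Qed.

Lemma shifts_shift c s v : shifts s (shift c v) = shift c (shifts s v).
Proof. by elim: s => //= d s ->; rewrite shiftC. Qed.

Lemma shifts_cat s t v : shifts (s ++ t) v = shifts s (shifts t v).
Proof. exact: foldr_cat. Qed.

Lemma shiftsC s t v : shifts s (shifts t v) = shifts t (shifts s v).
Proof. by elim: s => //= c s ->; rewrite shifts_shift. Qed.

Lemma iter_shift k c v : iter k (shift c) v = shifts (nseq k c) v.
Proof. by elim: k => //= k ->. Qed.

Lemma shifts_partition (P : pred K) s v :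
  shifts s v = shifts (filter P s) (shifts (filter (predC P) s) v).
Proof.
elim: s v => //= c s IH v; rewrite IH; case: (P c) => //=.
by rewrite shifts_shift.
Qed.

Lemma subspace_shifts_kernel (P : K -> Prop) :
  subspace [set v | exists2 s, (forall c, c \in s -> P c) & shifts s v = 0].
Proof.
split=> [|a u v [s Ps su] [t Pt tv]]; first by exists [::].
exists (s ++ t) => [c|]; first by rewrite mem_cat => /orP[/Ps|/Pt].
rewrite shifts_linear !shifts_cat tv (linear_0 (shifts_linear s)) addr0.
by rewrite shiftsC su (linear_0 (shifts_linear t)) scaler0.
Qed.

Section Stable.
Variable N : set M.
Hypotheses (sN : subspace N) (TN : forall v, N v -> N (T v)).

Lemma shift_stable c v : N v -> N (shift c v).
Proof. by move=> Nv; apply: (subspaceB sN); [exact: TN|exact: subspaceZ]. Qed.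

Lemma shifts_stable s v : N v -> N (shifts s v).
Proof. by elim: s => //= c s IH /IH; exact: shift_stable. Qed.

(** Modulo N the product of the T - d, for d in s, multiplies a c-eigenvector
    by the product of the c - d, which is invertible. *)
Lemma eigenvector_mod c s v :
  N (shift c v) -> N (shifts s v) -> c \notin s -> N v.
Proof.
move=> cv; elim: s => //= d s IH; rewrite inE negb_or => + /andP[cd cs].
move=> dv; apply: IH cs.
have Ncs : N (shift c (shifts s v)).
  by rewrite -shifts_shift; exact: shifts_stable.
have := subspaceB sN dv Ncs.
rewrite /shift opprB addrC addrA subrK -scalerBl => /(subspaceZ sN (c - d)^-1).
by rewrite scalerA mulVf ?scale1r // subr_eq0.
Qed.

End Stable.

(** A power of T - c and a product of operators T - d with d <> c are coprime
    polynomials in T. *)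
Lemma generalized_eigenvector_eq0 c k s v :
  shifts (nseq k c) v = 0 -> shifts s v = 0 -> c \notin s -> v = 0.
Proof.
move=> + sv cs; elim: k v sv => //= k IH v sv ckv.
suff : [set 0] v by [].
apply: (eigenvector_mod subspace_set0 _ _ _ cs) => //=.
- by move=> _ ->; exact: linear_0.
- apply: IH; first by rewrite shifts_shift sv (linear_0 (shift_linear c)).
  by rewrite shifts_shift.
Qed.

End ShiftedProducts.

(** * Subquotients of weak modules *)

HB.instance Definition _ (K : nzRingType) (M : lmodType K) (S : set M) :=
  GRing.isScaleClosed.Build K M (@span_pred K M S)
    (fun c v vS => asboolT (subspaceZ (span_subspace S) c (asboolW vS))).

Section SpanType.
Context {K : nzRingType} {M : lmodType K} (S : set M).

(** Taking the span of S makes this a vector space for every S, so that no proof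
    of closure has to be a parameter of the type. *)
Record span_type : Type := SpanElement {
  span_val : M;
  span_valP : span_val \in span_pred S }.

HB.instance Definition _ := [isSub for span_val].
HB.instance Definition _ := [Choice of span_type by <:].
HB.instance Definition _ := [SubChoice_isSubLmodule of span_type by <:].

Lemma span_val_linear : linear span_val.
Proof. by move=> c u v; rewrite -[span_val _]/(\val _) linearP. Qed.

End SpanType.

Section Subquotients.
Context {R : realType} {V : vertex_operator_algebra R}.
Implicit Types (M Q : weak_module V).

Lemma spanK (K : nzRingType) (M : lmodType K) (S : set M) :
  subspace S -> span S = S.
Proof.
by move=> sS; apply/seteqP; split=> [v|]; [apply|exact: sub_span].
Qed.

Lemma module_axiomsP M : module_axioms (@wm_Y R V M).
Proof. by case: M. Qed.

Lemma quotient_weak_module M (N : set M) : weak_submodule N ->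
  exists (Q : weak_module V) (f : M -> Q),
    [/\ linear f, forall a n u, f (wm_Y a n u) = wm_Y a n (f u),
        forall v, exists u, f u = v & forall u, f u = 0 <-> N u].
Proof.
move=> [sN YN].
pose YQ a n (x : quotient_space N) : quotient_space N :=
  quotient_proj N (wm_Y a n (quotient_repr x)).
have fl : linear (quotient_proj N).
  by move=> c u v; rewrite quotient_projD -quotient_projZ.
have fY a n u : quotient_proj N (wm_Y a n u) = YQ a n (quotient_proj N u).
  apply/quotient_projP; rewrite spanK // -(linear_B (modes_linear_vector _ _)).
  apply: YN; set x := u - _; suff : span N x by rewrite spanK.
  by apply/quotient_projP; rewrite quotient_reprK.
have fs v : exists u, quotient_proj N u = v.
  by exists (quotient_repr v); rewrite quotient_reprK.
have [Ql Qt Qv Qj] := module_axioms_image fl fY fs (module_axiomsP M).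
exists (WeakModule Ql Qt Qv Qj), (quotient_proj N); split=> // u.
rewrite -(linear_0 fl); split=> [/quotient_projP|Nu].
  by rewrite subr0 spanK.
by apply/quotient_projP; rewrite subr0 spanK.
Qed.

Lemma sub_weak_module M (N : set M) : weak_submodule N ->
  exists (Q : weak_module V) (f : Q -> M),
    [/\ linear f, forall a n u, f (wm_Y a n u) = wm_Y a n (f u),
        injective f & forall u, N u <-> exists v, f v = u].
Proof.
move=> [sN YN].
have valN (x : span_type N) : N (span_val x).
  by have := span_valP x; rewrite -{3}(spanK sN) => /asboolP.
have inN u : N u -> u \in span_pred N.
  by move=> Nu; apply/asboolP; exact: sub_span.
pose YQ a n (x : span_type N) : span_type N :=
  SpanElement (inN _ (YN a n _ (valN x))).
have fY a n x : span_val (YQ a n x) = wm_Y a n (span_val x) by [].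
have fi : injective (@span_val _ _ N) := val_inj.
have [Ql Qt Qv Qj] :=
  module_axioms_sub (@span_val_linear _ _ N) fY fi (module_axiomsP M).
exists (WeakModule Ql Qt Qv Qj), (@span_val _ _ N); split=> //.
move=> u; split=> [Nu|[x <-]]; last exact: valN.
by exists (SpanElement (inN u Nu)).
Qed.

Lemma maximal_submodule_avoiding M (N : set M) (u : M) :
  weak_submodule N -> ~ N u ->
  exists T : set M, [/\ weak_submodule T, N `<=` T, ~ T u &
    forall T', weak_submodule T' -> T `<=` T' -> ~ T' u -> T' `<=` T].
Proof.
move=> wN Nu.
(* joining N to A makes the empty chain harmless: its union yields N itself *)
pose P (A : set M) := weak_submodule (N `|` A) /\ ~ (N `|` A) u.
have P0 : P set0 by rewrite /P setU0; split.
have [|A [[wA Au] Amax]] := @Zorn_bigcup M P; last first.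
  exists (N `|` A); split=> // T' wT' AT' T'u.
  have NT' : N `|` T' = T' by apply/setUidPr => x Nx; apply: AT'; left.
  have /Amax : P T' by rewrite /P NT'.
  move=> nAT'; apply: contrapT => nT'; apply: (Amax T'); last by rewrite /P NT'.
  split=> [x Ax|T'A]; first by apply: AT'; right.
  by apply: nT' => x /T'A; right.
move=> C CP Ctot.
have C2 x y : (N `|` \bigcup_(X in C) X) x -> (N `|` \bigcup_(X in C) X) y ->
    exists X, [/\ P X, X `<=` \bigcup_(X in C) X, (N `|` X) x & (N `|` X) y].
  move=> [Nx|[X CX Xx]] [Ny|[Y CY Yy]].
  - by exists set0; split=> //; left.
  - by exists Y; split; [exact: CP|exact: bigcup_sup|left|right].
  - by exists X; split; [exact: CP|exact: bigcup_sup|right|left].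
  - have [XY|YX] := Ctot _ _ CX CY.
      by exists Y; split; [exact: CP|exact: bigcup_sup|right; exact: XY|right].
    by exists X; split; [exact: CP|exact: bigcup_sup|right|right; exact: YX].
have sub X : X `<=` \bigcup_(X in C) X ->
    N `|` X `<=` N `|` \bigcup_(X in C) X by exact: setUS.
split; last first.
  by move=> uC; have [X [[_ Xu] _ /Xu]] := C2 _ _ uC uC.
split; first split; first by left; exact: wN.1.1.
- move=> c x y Cx Cy; have [X [[[sX _] _] XC Xx Xy]] := C2 _ _ Cx Cy.
  by apply: (sub _ XC); exact: sX.2.
- move=> a n x Cx; have [X [[[_ YX] _] XC Xx _]] := C2 _ _ Cx Cx.
  by apply: (sub _ XC); exact: YX.
Qed.

Lemma weak_submodule_preimage M Q (f : M -> Q) (N : set Q) :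
  linear f -> (forall a n u, f (wm_Y a n u) = wm_Y a n (f u)) ->
  weak_submodule N -> weak_submodule (f @^-1` N).
Proof.
move=> fl fY [sN YN]; split; first exact: subspace_preimage.
by move=> a n u Nu; rewrite /preimage /= fY; exact: YN.
Qed.

Lemma weak_submodule_image M Q (f : M -> Q) (N : set M) :
  linear f -> (forall a n u, f (wm_Y a n u) = wm_Y a n (f u)) ->
  weak_submodule N -> weak_submodule (f @` N).
Proof.
move=> fl fY [sN YN]; split; last first.
  by move=> a n _ [u Nu <-]; rewrite -fY; exists (wm_Y a n u) => //; exact: YN.
split; first by exists 0; [exact: subspace_0|exact: linear_0].
move=> c _ _ [u Nu <-] [v Nv <-]; rewrite -fl.
by exists (c *: u + v) => //; exact: sN.2.
Qed.

(** Modes of homogeneous states send x to L(0)-eigenvectors with eigenvalues in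
    mu + N, or to 0.  These vectors span Q, so the L(0)-eigenspaces themselves
    form an admissible grading. *)
Lemma lowest_weight_simple Q (x : Q) (mu : R[i]) :
  x <> 0 -> module_L Q 0 x = mu *: x ->
  (forall p a n, voa_wt p a -> p - n - 1 < 0 -> wm_Y a n x = 0) ->
  (forall X : set Q, weak_submodule X -> X <> [set 0] -> X = setT) ->
  lowest_weights V mu.
Proof.
move=> x0 Lx low simQ.
pose E n := eigenspace_of (module_L Q 0) (mu + n%:R).
have sE n : subspace (E n) by apply: subspace_eigenspace; exact: L0_linear.
have genQ v : mode_span [set x] v.
  rewrite (simQ (mode_span [set x])) //; first exact: mode_span_submodule.
  move=> x_0; apply: x0; have : mode_span [set x] x by exact: sub_mode_span.
  by rewrite x_0.
have modeE p a n m v : voa_wt p a -> E m v ->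
    module_L Q 0 (wm_Y a n v) = (mu + (p + m%:Z - n - 1)%:~R) *: wm_Y a n v.
  move=> wt_a Ev; rewrite (L0_mode _ _ wt_a) (Ev : _ = _).
  rewrite (linear_Z (modes_linear_vector _ _)) -scalerDl -addrA.
  rewrite -[m%:R]/(m%:~R) -intrD; congr ((_ + _%:~R) *: _); lia.
have E0x : E 0 x by rewrite /E addr0.
have dE : direct_sum E.
  apply: direct_sum_of_independent => //.
    move=> W sW EW v; apply: (mode_span_ind sW) (genQ v) => p a n _ wt_a ->.
    have := modeE p a n 0%N x wt_a E0x.
    case kE : (p + 0%:Z - n - 1) => [k|k] Lv; first exact: (EW k).
    rewrite (low p) //; last by lia.
    exact: (subspace_0 sW).
  move=> s f us Ef; apply: (eigenspaces_independent _ _ us Ef).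
    exact: L0_linear.
  by move=> i j /addrI /eqP; rewrite eqr_nat => /eqP.
(* Q is spanned by eigenspaces for mu + N, so it has no other eigenvalue *)
have neg0 k v : module_L Q 0 v = (mu + (Negz k)%:~R) *: v -> v = 0.
  move=> Lv.
  have [s sE' sv] : [set v | exists2 s, (forall c, c \in s ->
      exists n, c = mu + n%:R) & shifts (module_L Q 0) s v = 0] v.
    apply: (direct_sum_ind dE); first exact/subspace_shifts_kernel/L0_linear.
    move=> n w Ew; exists [:: mu + n%:R].
      by move=> c; rewrite inE => /eqP ->; exists n.
    by rewrite /= /shift (Ew : _ = _) subrr.
  have shv : shifts (module_L Q 0) (nseq 1 (mu + (Negz k)%:~R)) v = 0.
    by rewrite /= /shift Lv subrr.
  apply: (generalized_eigenvector_eq0 (@L0_linear _ _ Q) shv sv).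
  apply/negP => /sE'[n /addrI /eqP]; rewrite -[n%:R]/(n%:~R) eqr_int.
  lia.
have act : forall (k : int) (a : V), voa_wt k a -> forall (n : int) (m : nat)
    (v : Q), E m v -> int_grading E (k + m%:Z - n - 1) (wm_Y a n v).
  move=> k a wt_a n m v Ev; have := modeE _ _ n _ _ wt_a Ev.
  by case: (k + m%:Z - n - 1) => [j|j]; [|exact: neg0].
exists (AdmissibleModule dE act); split; last first.
  split=> //= E0; apply: x0; have : E 0 x by [].
  by rewrite /E addr0 E0.
split=> [||N' [sN' YN' _] _].
- by split.
- move=> T0; apply: x0; have : [set: Q] x by [].
  by rewrite T0.
- have [N0|N0] := pselect (N' = [set 0]); first by left.
  by right; exact: (simQ _ (conj sN' YN')).
Qed.

(** Let T be a largest submodule containing N but not u.  A nonzero submodule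
    of the module generated by the image of u in M/T has a preimage strictly
    larger than T, so it contains that image: the module is irreducible. *)
Lemma lowest_weight_of_singular M (N : set M) (u : M) (mu : R[i]) :
  weak_submodule N -> ~ N u -> N (module_L M 0 u - mu *: u) ->
  (forall p a n, voa_wt p a -> p - n - 1 < 0 -> N (wm_Y a n u)) ->
  lowest_weights V mu.
Proof.
move=> wN Nu Lu low.
have [T [wT NT Tu Tmax]] := maximal_submodule_avoiding wN Nu.
have [Q [f [fl fY fs fK]]] := quotient_weak_module wT.
have [S [g [gl gY gi gS]]] := sub_weak_module (mode_span_submodule [set f u]).
have [x xE] : exists x, g x = f u.
  by apply/gS; exact: sub_mode_span.
apply: (@lowest_weight_simple S x mu).
- by move=> x0; apply: Tu; apply/fK; rewrite -xE x0 (linear_0 gl).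
- apply: gi; rewrite /module_L /virasoro_mode gY (linear_Z gl) xE -fY.
  rewrite -(linear_Z fl); apply/eqP; rewrite -subr_eq0 -(linear_B fl).
  by apply/eqP/fK/NT; exact: Lu.
- move=> p a n wt_a neg; apply: gi; rewrite gY xE -fY (linear_0 gl).
  by apply/fK/NT; exact: low wt_a neg.
move=> X wX X0.
have [y Xy y0] := neq_set0P wX.1 X0.
pose T' := f @^-1` (g @` X).
have wT' : weak_submodule T'.
  by apply: weak_submodule_preimage => //; exact: weak_submodule_image.
have TT' : T `<=` T'.
  move=> v /fK Tv; exists 0; first exact: (subspace_0 wX.1).
  by rewrite Tv (linear_0 gl).
have [z Xz gz] : T' u.
  apply: contrapT => T'u; apply: y0; apply: gi.
  have [v fv] := fs (g y).
  have /fK : T v by apply: (Tmax _ wT' TT' T'u); exists y.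
  by rewrite fv (linear_0 gl).
have Xx : X x by have <- : z = x by apply: gi; rewrite gz.
apply/seteqP; split=> // v _.
have : mode_span [set f u] (g v) by apply/gS; exists v.
have wgX := weak_submodule_image gl gY wX.
have fuX : [set f u] `<=` g @` X by move=> _ ->; exists x.
by move=> /(mode_span_sub wgX fuX)[w Xw /gi <-].
Qed.

End Subquotients.

(** * The zero-mode action of Zhu's algebra *)

Lemma fsum_nat_linear (K : nzRingType) (M M' : lmodType K)
    (G : nat -> M -> M') : (forall i, linear (G i)) ->
  (forall v, exists k : nat, forall i, (k <= i)%N -> G i v = 0) ->
  linear (fun v => \sum_(i \in [set: nat]) G i v).
Proof.
move=> Gl Gt c u v; have [k uk] := Gt u; have [l vl] := Gt v.
rewrite !(@fsum_nat _ _ (maxn k l)).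
- by rewrite scaler_sumr -big_split /=; apply: eq_bigr => i _; rewrite Gl.
- by move=> i; rewrite geq_max => /andP[_]; exact: vl.
- by move=> i; rewrite geq_max => /andP[ki _]; exact: uk.
- move=> i; rewrite geq_max => /andP[ki li].
  by rewrite Gl uk // vl // scaler0 addr0.
Qed.

Section ZeroModes.
Context {R : realType} {V : vertex_operator_algebra R} {M : weak_module V}.
Implicit Types (a b : V) (u v w : M) (W U : set M) (k m n p q : int).

Lemma wt_mode p q a b n : voa_wt p a -> voa_wt q b ->
  voa_wt (p + q - n - 1) (voa_Y a n b).
Proof.
move=> wt_a wt_b; have := @L0_mode R V (@adjoint_module R V) p a n b wt_a.
rewrite /module_L /= (wt_b : virasoro_mode _ _ _ _ = _) => Lab.
rewrite /voa_wt /eigenspace_of /= Lab.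
rewrite (linear_Z ((voa_bilinear V).2 a n)) -scalerDl -intrD.
by congr (_%:~R *: _); lia.
Qed.

Lemma wt_vac : voa_wt 0 (voa_vac V).
Proof.
by rewrite /voa_wt /eigenspace_of /= /virasoro_mode voa_creation //= scale0r.
Qed.

(** L(0) L(-2) 1 = 2 L(-2) 1, by the Virasoro relations and L(0) 1 = 0. *)
Lemma wt_omega : voa_wt 2 (voa_omega V).
Proof.
have [c /(_ 0 (-2) (voa_vac V))] := voa_virasoro V.
have L2 : virasoro_mode (voa_omega V) (@voa_Y R V) (-2) (voa_vac V)
    = voa_omega V.
  by rewrite /virasoro_mode voa_creation.
rewrite L2 (wt_vac : virasoro_mode _ _ _ _ = _) scale0r.
rewrite {2}/virasoro_mode (linear_0 ((voa_bilinear V).2 _ _)) subr0 !add0r /=.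
by rewrite addr0 opprK.
Qed.

Definition singular u : Prop :=
  forall p a n, voa_wt p a -> p - n - 1 < 0 -> wm_Y a n u = 0.

Definition zero_mode a u : M :=
  \sum_(n \in [set: int]) wm_Y (components (@voa_wt R V) a n) (n - 1) u.

Lemma zero_mode_homogeneous p a u : voa_wt p a ->
  zero_mode a u = wm_Y a (p - 1) u.
Proof.
apply: (fsum_components_homogeneous (voa_grading V)
          (g := fun n a => wm_Y a (n - 1) u)) => n.
exact: (linear_0 (modes_linear_state _ _)).
Qed.

Lemma zero_mode_linear_state u : linear (zero_mode^~ u).
Proof.
apply: (fsum_components_linear (voa_grading V)
          (g := fun n a => wm_Y a (n - 1) u)) => n.
exact: modes_linear_state.
Qed.

Lemma zero_mode_linear_vector a : linear (zero_mode a).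
Proof.
apply: (direct_sum_ind (voa_grading V) (W := [set a | linear (zero_mode a)])).
  split=> [c u v|c a1 a2 a1l a2l d u v].
    by rewrite !(linear_0 (zero_mode_linear_state _)) scaler0 addr0.
  rewrite !zero_mode_linear_state a1l a2l !scalerDr !scalerA.
  by rewrite [c * d]mulrC addrACA.
move=> p {}a wt_a c u v; rewrite !(zero_mode_homogeneous _ wt_a).
exact: modes_linear_vector.
Qed.

Lemma zhu_residue_linear_left k b : linear (fun a => zhu_residue k a b).
Proof.
apply: (fsum_components_linear (voa_grading V) (g := fun n a =>
   \sum_(i \in [set: nat]) binz R[i] n i *: voa_Y a (k + i%:Z) b)) => n.
apply: fsum_nat_linear => [i c a1 a2|a].
  by rewrite (voa_bilinear V).1 scalerDr !scalerA mulrC.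
have [N aN] := truncation_nat (@voa_truncation R V) a b k.
by exists N => i /aN ->; rewrite scaler0.
Qed.

Lemma zhu_residue_homogeneous k p a b : voa_wt p a ->
  zhu_residue k a b
  = \sum_(i \in [set: nat]) binz R[i] p i *: voa_Y a (k + i%:Z) b.
Proof.
apply: (fsum_components_homogeneous (voa_grading V) (g := fun n a =>
   \sum_(i \in [set: nat]) binz R[i] n i *: voa_Y a (k + i%:Z) b)) => n.
rewrite fsbig1 // => i _.
by rewrite (linear_0 ((voa_bilinear V).1 _ _)) scaler0.
Qed.

Lemma zhu_residue_linear_right k a : linear (zhu_residue k a).
Proof.
apply: (direct_sum_ind (voa_grading V)
  (W := [set a | linear (zhu_residue k a)])).
  split=> [c u v|c a1 a2 a1l a2l d u v].
    by rewrite !(linear_0 (zhu_residue_linear_left _ _)) scaler0 addr0.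
  rewrite !zhu_residue_linear_left a1l a2l !scalerDr !scalerA.
  by rewrite [c * d]mulrC addrACA.
move=> p {}a wt_a c u v; rewrite !(zhu_residue_homogeneous _ _ wt_a).
apply: (fsum_nat_linear (G := fun i b =>
   binz R[i] p i *: voa_Y a (k + i%:Z) b)) => [i d b1 b2|b].
  by rewrite (voa_bilinear V).2 scalerDr !scalerA mulrC.
have [N aN] := truncation_nat (@voa_truncation R V) a b k.
by exists N => i /aN ->; rewrite scaler0.
Qed.

(** The iterate side of the Jacobi identity for l = k, m = wt a and
    n = wt b - k - 2 is the zero mode of the residue, as binz p i is the
    coefficient of z ^ i in (1 + z) ^ wt(a).  The second product vanishes,
    because a(wt a + i) has negative weight. *)
Lemma zero_mode_zhu_residue k p q a b u : singular u ->
  voa_wt p a -> voa_wt q b ->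
  zero_mode (zhu_residue k a b) u
  = \sum_(i \in [set: nat]) ((-1) ^+ i * binz R[i] k i) *:
      wm_Y a (k + p - i%:Z) (wm_Y b (q - k - 2 + i%:Z) u).
Proof.
move=> su wt_a wt_b; rewrite (zhu_residue_homogeneous k b wt_a).
have [N aN] := truncation_nat (@voa_truncation R V) a b k.
rewrite (linear_fsum (zero_mode_linear_state u)); last first.
  by apply: (@nat_finite_support _ _ N) => i /aN ->; rewrite scaler0.
transitivity (jacobi_right (@wm_Y R V M) a b u k p (q - k - 2)).
  apply: eq_fsbigr => i _; rewrite (linear_Z (zero_mode_linear_state u)).
  rewrite (zero_mode_homogeneous u (wt_mode _ wt_a wt_b)).
  by congr (_ *: wm_Y _ _ _); lia.
rewrite -[LHS]wm_jacobi [X in _ - X]fsbig1 ?subr0 // => i _.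
rewrite (su p a) //; last by lia.
by rewrite (linear_0 (modes_linear_vector _ _)) scaler0.
Qed.

(** For k = - 2 the remaining product involves b(wt b + i), of negative
    weight. *)
Lemma zero_mode_circ a b u : singular u -> zero_mode (zhu_circ a b) u = 0.
Proof.
move=> su; rewrite -[RHS](linear_0 (zero_mode_linear_state u)).
apply: (linear_ext (voa_grading V)
  (f := fun a => zero_mode (zhu_circ a b) u) (g := fun=> zero_mode 0 u)).
- move=> c a1 a2; rewrite /zhu_circ zhu_residue_linear_left.
  exact: zero_mode_linear_state.
- move=> c a1 a2.
  by rewrite !(linear_0 (zero_mode_linear_state u)) scaler0 addr0.
move=> p {}a wt_a; apply: (linear_ext (voa_grading V)
  (f := fun b => zero_mode (zhu_circ a b) u) (g := fun=> zero_mode 0 u)).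
- move=> c b1 b2; rewrite /zhu_circ zhu_residue_linear_right.
  exact: zero_mode_linear_state.
- move=> c b1 b2.
  by rewrite !(linear_0 (zero_mode_linear_state u)) scaler0 addr0.
move=> q {}b wt_b; rewrite (zero_mode_zhu_residue _ su wt_a wt_b).
rewrite (linear_0 (zero_mode_linear_state u)) fsbig1 // => i _.
rewrite (su q b) //; last by lia.
by rewrite (linear_0 (modes_linear_vector _ _)) scaler0.
Qed.

(** For k = - 1 the remaining product involves b(wt b - 1 + i), which has
    negative weight unless i = 0. *)
Lemma zero_mode_star a b u : singular u ->
  zero_mode (zhu_star a b) u = zero_mode a (zero_mode b u).
Proof.
move=> su; apply: (linear_ext (voa_grading V)
  (f := fun a => zero_mode (zhu_star a b) u)
  (g := fun a => zero_mode a (zero_mode b u))).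
- move=> c a1 a2; rewrite /zhu_star zhu_residue_linear_left.
  exact: zero_mode_linear_state.
- exact: zero_mode_linear_state.
move=> p {}a wt_a; apply: (linear_ext (voa_grading V)
  (f := fun b => zero_mode (zhu_star a b) u)
  (g := fun b => zero_mode a (zero_mode b u))).
- move=> c b1 b2; rewrite /zhu_star zhu_residue_linear_right.
  exact: zero_mode_linear_state.
- by move=> c b1 b2; rewrite zero_mode_linear_state zero_mode_linear_vector.
move=> q {}b wt_b; rewrite (zero_mode_zhu_residue _ su wt_a wt_b).
rewrite (@fsum_single _ _ 0%N) => [|i i0].
  rewrite expr0 binz0 mulr1 scale1r.
  rewrite (zero_mode_homogeneous _ wt_a) (zero_mode_homogeneous _ wt_b).
  by congr (wm_Y _ _ (wm_Y _ _ _)); lia.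
rewrite (su q b) //; last by lia.
by rewrite (linear_0 (modes_linear_vector _ _)) scaler0.
Qed.

Lemma zero_mode_vac u : zero_mode (voa_vac V) u = u.
Proof. by rewrite (zero_mode_homogeneous u wt_vac) wm_vacuum. Qed.

(** By [zhu_action_proj] the choice of representative does not matter on
    singular vectors. *)
Definition zhu_action (x : zhu_algebra V) u : M :=
  zero_mode (quotient_repr x) u.

Lemma zhu_action_proj a u : singular u ->
  zhu_action (quotient_proj _ a) u = zero_mode a u.
Proof.
move=> su; apply/eqP; rewrite -subr_eq0 -(linear_B (zero_mode_linear_state u)).
apply/eqP; set d := _ - _.
suff /(_ (zero_mode^~ u @^-1` [set 0])) :
    span [set x : V | exists a b : V, x = zhu_circ a b] d.
  apply; last by move=> _ [a1 [b1 ->]]; exact: zero_mode_circ.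
  exact: (subspace_preimage (zero_mode_linear_state u) subspace_set0).
by apply/quotient_projP; rewrite quotient_reprK.
Qed.

Lemma zhu_action_linear u : singular u -> linear (zhu_action^~ u).
Proof.
move=> su c x y; rewrite -[x in LHS]quotient_reprK -[y in LHS]quotient_reprK.
rewrite -[_ *: _]quotient_projZ -quotient_projD zhu_action_proj //.
by rewrite !quotient_reprK; exact: zero_mode_linear_state.
Qed.

Lemma zhu_action_mul x y u : singular u ->
  zhu_action (zhu_mul x y) u = zhu_action x (zhu_action y u).
Proof. by move=> su; rewrite zhu_action_proj // zero_mode_star. Qed.

Definition zero_mode_stable W : Prop :=
  subspace W /\ forall a w, W w -> W (zero_mode a w).

Definition minimal_zero_mode_stable W : Prop :=
  [/\ zero_mode_stable W, W <> [set 0] &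
    forall W', zero_mode_stable W' -> W' `<=` W -> W' = [set 0] \/ W' = W].

(** The map sending x in J to its action on u is one of modules, so the preimage
    of a stable subspace of the image is a left ideal contained in J. *)
Lemma zhu_action_minimal (J : set (zhu_algebra V)) U u :
  minimal_left_ideal (@zhu_mul R V) J ->
  zero_mode_stable U -> U `<=` singular -> U u ->
  let W := [set zhu_action x u | x in J] in
  W `<=` U /\ (W = [set 0] \/ minimal_zero_mode_stable W).
Proof.
move=> [[sJ mulJ] J0 Jmin] [sU oU] Using Uu W.
have su := Using _ Uu.
have WU : W `<=` U by move=> _ [x _ <-]; exact: oU.
split=> //; have [W0|W0] := pselect (W = [set 0]); first by left.
right; split=> //.
  split; last first.
    move=> a _ [x Jx <-]; exists (zhu_mul (quotient_proj _ a) x).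
      exact: mulJ.
    rewrite zhu_action_mul // zhu_action_proj //.
    by apply: Using; exact: oU.
  split.
    by exists 0; [exact: subspace_0|exact: linear_0 (zhu_action_linear su)].
  move=> c _ _ [x Jx <-] [y Jy <-]; exists (c *: x + y); first exact: sJ.2.
  exact: zhu_action_linear.
move=> W' [sW' oW'] W'W.
have [|x []//|J'0|J'E] := Jmin (J `&` (zhu_action^~ u @^-1` W')).
- split.
    exact: (subspaceI sJ (subspace_preimage (zhu_action_linear su) sW')).
  move=> a x [Jx W'x]; split; first exact: mulJ.
  by rewrite /preimage /= zhu_action_mul //; exact: oW'.
- left; apply/seteqP; split=> [w W'w|_ ->]; last exact: subspace_0.
  have [x Jx xw] := W'W _ W'w.
  have : (J `&` (zhu_action^~ u @^-1` W')) x.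
    by split=> //; rewrite /preimage /= xw.
  rewrite J'0 => x0; rewrite -xw (x0 : x = 0).
  exact: (linear_0 (zhu_action_linear su)).
right; apply/seteqP; split=> // _ [x Jx <-].
by have : J x by []; rewrite -J'E => -[].
Qed.

(** u is the image of u under 1, and 1 is a sum of elements of minimal left
    ideals. *)
Lemma singular_completely_reducible U u :
  semisimple_algebra (@zhu_mul R V) ->
  zero_mode_stable U -> U `<=` singular -> U u ->
  span (\bigcup_(W in [set W | W `<=` U /\ minimal_zero_mode_stable W]) W) u.
Proof.
move=> [I [J [Jmin dJ]]] oU Using Uu; have su := Using _ Uu.
set S := \bigcup_(W in _) W.
have sS := span_subspace S.
suff act x : span S (zhu_action x u).
  by rewrite -[u]zero_mode_vac -zhu_action_proj.
move: x; apply: (direct_sum_ind dJ).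
  exact: (subspace_preimage (zhu_action_linear su) sS).
move=> i x Jx; have [WU Wmin] := zhu_action_minimal (Jmin i) oU Using Uu.
have Wx : [set zhu_action x u | x in J i] (zhu_action x u) by exists x.
case: Wmin => [W0|Wmin].
  by rewrite W0 in Wx; rewrite /preimage /= Wx; exact: subspace_0.
by apply: sub_span; exists [set zhu_action x u | x in J i].
Qed.

End ZeroModes.

(** * Modules with weights in lambda + N *)

Section WeightSpaces.
Context {R : realType} {V : vertex_operator_algebra R} (M : weak_module V).
Variable lambda : R[i].
Implicit Types (a b : V) (u v w : M) (N S W : set M).

Local Notation L0 := (module_L M 0).
Local Notation lowest := (generalized_eigenspace M lambda).

(** Each vector of M is killed by a product of operators L(0) - lambda - n.
    This says, without mention of components, that M is the sum of its
    generalized eigenspaces for lambda + N. *)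
Hypothesis spanned : forall v : M,
  exists2 s, (forall c, c \in s -> exists n : nat, c = lambda + n%:R)
    & shifts L0 s v = 0.

Let L0l : linear L0. Proof. exact: L0_linear. Qed.

Lemma shift_mode p a n c v : voa_wt p a ->
  shift L0 (c + (p - n - 1)%:~R) (wm_Y a n v) = wm_Y a n (shift L0 c v).
Proof.
move=> wt_a; rewrite /shift (L0_mode _ _ wt_a).
rewrite (linear_B (modes_linear_vector _ _)).
rewrite (linear_Z (modes_linear_vector _ _)).
by rewrite scalerDl opprD addrACA subrr addr0.
Qed.

Lemma shifts_nseq_mode p a n c k v : voa_wt p a ->
  shifts L0 (nseq k (c + (p - n - 1)%:~R)) (wm_Y a n v)
  = wm_Y a n (shifts L0 (nseq k c) v).
Proof. by move=> wt_a; elim: k => //= k ->; exact: shift_mode. Qed.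

Lemma lowestE v : lowest v <-> exists k, shifts L0 (nseq k lambda) v = 0.
Proof.
have iterE k : iter k (fun w => L0 w - lambda *: w) v
    = shifts L0 (nseq k lambda) v by exact: iter_shift.
by split=> -[k vk]; exists k; rewrite ?iterE // -iterE.
Qed.

Lemma subspace_lowest : subspace lowest.
Proof.
rewrite (_ : lowest = [set v | exists2 s, (forall c, c \in s -> c = lambda)
    & shifts L0 s v = 0]); first exact: subspace_shifts_kernel.
apply/seteqP; split=> v; first move=> /lowestE[k vk].
  by exists (nseq k lambda) => // c; rewrite mem_nseq => /andP[_ /eqP].
move=> [s sl sv]; apply/lowestE; exists (size s).
suff <- : s = nseq (size s) lambda by [].
by apply/all_pred1P/allP => c /sl ->; exact: eqxx.
Qed.

Lemma below_lowest N c v (k : nat) :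
  subspace N -> (forall v, N v -> N (L0 v)) ->
  c = lambda + (Negz k)%:~R -> N (shift L0 c v) -> N v.
Proof.
move=> sN LN cE cv; have [s sl sv] := spanned v.
apply: (eigenvector_mod L0l sN LN cv (s := s)).
  by rewrite sv; exact: subspace_0.
rewrite cE; apply/negP => /sl[n /addrI /eqP].
by rewrite -[n%:R]/(n%:~R) eqr_int; lia.
Qed.

Lemma lowest_singular : lowest `<=` singular.
Proof.
move=> u /lowestE[k uk] p a n wt_a neg.
have [s sl sv] := spanned (wm_Y a n u).
have killed := shifts_nseq_mode n lambda k u wt_a.
rewrite uk (linear_0 (modes_linear_vector _ _)) in killed.
apply: (generalized_eigenvector_eq0 L0l killed sv).
apply/negP => /sl[m /addrI /eqP].
by rewrite -[m%:R]/(m%:~R) eqr_int; lia.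
Qed.

Lemma zero_mode_lowest : zero_mode_stable lowest.
Proof.
split=> [|a u uk]; first exact: subspace_lowest.
apply: (subspace_fsum subspace_lowest) => p.
have wt_a := components_in (voa_grading V) a p.
have [k {}uk] := (lowestE u).1 uk; apply/lowestE; exists k.
have := shifts_nseq_mode (p - 1) lambda k u wt_a.
rewrite (_ : p - (p - 1) - 1 = 0); last lia.
by rewrite addr0 uk (linear_0 (modes_linear_vector _ _)).
Qed.

(** Among the a(n) w those of weight lambda are zero modes applied to w, those
    below vanish, and the others have weights in lambda + Z_+, so that a sum of
    them in the lowest space is 0. *)
Lemma mode_span_lowest W : zero_mode_stable W -> W `<=` lowest ->
  mode_span W `&` lowest `<=` W.
Proof.
move=> [sW oW] Wl.
pose higher := [set v | exists2 s, (forall c, c \in s ->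
  exists n : nat, (0 < n)%N /\ c = lambda + n%:R) & shifts L0 s v = 0].
have sh : subspace higher by exact: subspace_shifts_kernel.
suff dec v : mode_span W v -> exists2 w, W w & higher (v - w).
  move=> v [/dec[w Ww [s sl svw]] lv].
  have /lowestE[k vwk] : lowest (v - w).
    by apply: (subspaceB subspace_lowest) => //; exact: Wl.
  suff /eqP : v - w = 0 by rewrite subr_eq0 => /eqP ->.
  apply: (generalized_eigenvector_eq0 L0l vwk svw).
  apply/negP => /sl[n [n0 /eqP]]; rewrite -subr_eq0 opprD addNKr oppr_eq0.
  by rewrite pnatr_eq0; lia.
move: v; apply: mode_span_ind.
  split=> [|c u v [w Ww uw] [x Wx vx]].
    by exists 0; [exact: subspace_0|rewrite subrr; exact: subspace_0].
  exists (c *: w + x); first exact: sW.2.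
  by rewrite opprD addrACA -scalerBr; exact: sh.2.
move=> p a n w wt_a Ww; have lw := Wl _ Ww.
case pn: (p - n - 1) => [[|j]|j].
- exists (wm_Y a n w); last by rewrite subrr; exact: subspace_0.
  have -> : n = p - 1 by lia.
  by rewrite -zero_mode_homogeneous //; exact: oW.
- exists 0; rewrite ?subr0; first exact: subspace_0.
  have [k wk] := (lowestE w).1 lw.
  exists (nseq k (lambda + j.+1%:R)).
    by move=> c; rewrite mem_nseq => /andP[_ /eqP ->]; exists j.+1.
  have := shifts_nseq_mode n lambda k w wt_a.
  by rewrite pn wk (linear_0 (modes_linear_vector _ _)).
- exists 0; rewrite ?subr0; first exact: subspace_0.
  by rewrite (lowest_singular lw wt_a); [exact: subspace_0|rewrite pn].
Qed.

Hypothesis no_higher : forall n : nat, (0 < n)%N ->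
  ~ lowest_weights V (lambda + n%:R).

(** Let u in S be an eigenvector modulo N of weight lambda + n.  By induction on
    n, operators of negative weight send u into N, so for n > 0 and u outside N
    the weight lambda + n would be the lowest weight of an irreducible
    module. *)
Lemma weak_submodule_lowest N S : weak_submodule N -> weak_submodule S ->
  S `&` lowest `<=` N -> S `<=` N.
Proof.
move=> wN wS SN.
have LN v : N v -> N (L0 v) by exact: weak_submodule_L0.
have LS v : S v -> S (L0 v) by exact: weak_submodule_L0.
have eigen n u : S u -> N (shift L0 (lambda + n%:R) u) -> N u.
  elim/ltn_ind: n u => n IH u Su Lu.
  have low p a m : voa_wt p a -> p - m - 1 < 0 -> N (wm_Y a m u).
    move=> wt_a neg; have Lw : N (shift L0
        (lambda + (n%:Z + (p - m - 1))%:~R) (wm_Y a m u)).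
      by rewrite intrD addrA shift_mode //; apply: wN.2.
    case jE : (n%:Z + (p - m - 1)) Lw => [j|j] Lw.
      by apply: (IH j) => //; [lia|exact: wS.2].
    exact: below_lowest wN.1 LN erefl Lw.
  case: n => [|n] in IH Lu *; last first.
    apply: contrapT => Nu; apply: (no_higher (ltn0Sn n)).
    exact: (lowest_weight_of_singular wN Nu).
  (* the factors L(0) - d with d <> lambda take u to the lowest space, and they
     act on u modulo N as a nonzero scalar *)
  rewrite addr0 in Lu; have [s _ su] := spanned u.
  rewrite (shifts_partition L0l (pred1 lambda)) in su.
  apply: (eigenvector_mod L0l wN.1 LN Lu
            (s := filter (predC (pred1 lambda)) s)).
    apply: SN; split; first exact: shifts_stable wS.1 LS _ _ Su.
    apply/lowestE; exists (size (filter (pred1 lambda) s)).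
    set t := filter (pred1 lambda) s in su *.
    suff <- : t = nseq (size t) lambda by [].
    by apply/all_pred1P; exact: filter_all.
  by rewrite mem_filter /= eqxx.
move=> v Sv; have [s sl sv] := spanned v.
have : N (shifts L0 s v) by rewrite sv; exact: (subspace_0 wN.1).
(* the factors L(0) - c are undone one by one, each time by [eigen] *)
elim: s sl {sv} => //= c s IH sl Ncs.
apply: IH => [d ds|]; first by apply: sl; rewrite inE ds orbT.
have [n cE] := sl c (mem_head _ _); apply: (eigen n); last by rewrite -cE.
exact: shifts_stable wS.1 LS _ _ Sv.
Qed.

End WeightSpaces.

(** * Complete reducibility *)

Section CompleteReducibility.
Context {R : realType} {V : vertex_operator_algebra R}.
Variables (M : admissible_module V) (lambda : R[i]).

Local Notation L0 := (module_L M 0).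
Local Notation lowest := (generalized_eigenspace M lambda).

Lemma degree_operator_linear : linear (@degree_operator R V M).
Proof.
apply: (fsum_components_linear (am_grading M) (g := fun n v => n%:R *: v)).
move=> n c u v.
by rewrite scalerDr !scalerA mulrC.
Qed.

Lemma degree_operator_homogeneous n (u : M) : am_gr n u ->
  degree_operator u = n%:R *: u.
Proof.
apply: (fsum_components_homogeneous (am_grading M)
          (g := fun n v => n%:R *: v)).
by move=> m; rewrite scaler0.
Qed.

Lemma admissible_submodule_weak (N : set M) :
  admissible_submodule N -> weak_submodule N.
Proof. by move=> [sN YN _]. Qed.

Lemma admissible_submoduleI (N N' : set M) :
  admissible_submodule N -> admissible_submodule N' ->
  admissible_submodule (N `&` N').
Proof.
move=> [sN YN dN] [sN' YN' dN']; split; first exact: subspaceI.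
  by move=> a n u [/YN ? /YN' ?].
by move=> u [/dN ? /dN' ?].
Qed.

Lemma admissible_submodule_sum (F : set (set M)) :
  F `<=` @admissible_submodule R V M ->
  admissible_submodule (span (\bigcup_(N in F) N)).
Proof.
move=> FM; set S := \bigcup_(N in F) N; have sS := span_subspace S.
have stable (f : M -> M) : linear f ->
    (forall N u, admissible_submodule N -> N u -> N (f u)) ->
    forall u, span S u -> span S (f u).
  move=> fl fN u Su; apply: (Su (f @^-1` span S)).
    exact: (subspace_preimage fl sS).
  move=> v [N FN Nv]; apply: sub_span; exists N => //.
  by apply: fN => //; exact: FM.
split=> // [a n|].
  apply: stable; first exact: modes_linear_vector.
  by move=> N u [_ YN _]; exact: YN.
apply: stable; first exact: degree_operator_linear.
by move=> N u [_ _ dN]; exact: dN.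
Qed.

Lemma mode_span_admissible (W : set M) n : W `<=` am_gr n ->
  admissible_submodule (mode_span W).
Proof.
move=> Wn; have [sW YW] := mode_span_submodule W; split=> //.
apply: mode_span_ind.
  exact: (subspace_preimage degree_operator_linear sW).
move=> p a m w wt_a Ww; rewrite /preimage /=.
have := am_graded_action wt_a m (Wn _ Ww).
case: (_ - _ - _) => [j|j] /= Yw.
  rewrite (degree_operator_homogeneous Yw).
  by apply: (subspaceZ sW); exact: mode_in_mode_span.
by rewrite Yw (linear_0 degree_operator_linear); exact: subspace_0.
Qed.

Hypothesis spanned : forall v : M,
  exists2 s, (forall c, c \in s -> exists n : nat, c = lambda + n%:R)
    & shifts L0 s v = 0.
Hypothesis no_higher : forall n : nat, (0 < n)%N ->
  ~ lowest_weights V (lambda + n%:R).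

(** A nonzero submodule N' meets the lowest space, and does so inside W, hence
    in all of W by minimality. *)
Lemma mode_span_irreducible (W : set M) n :
  W `<=` lowest -> W `<=` am_gr n -> minimal_zero_mode_stable W ->
  irreducible_submodule (mode_span W).
Proof.
move=> Wl Wn [[sW oW] W0 Wmin].
have aW := mode_span_admissible Wn.
split=> // [mW0|N' aN' N'W].
  have [w Ww w0] := neq_set0P sW W0; apply: w0.
  by have : mode_span W w by [exact: sub_mode_span]; rewrite mW0.
have wN' := admissible_submodule_weak aN'; have [sN' YN'] := wN'.
have N'lW : N' `&` lowest `<=` W.
  move=> v [/N'W Wv lv].
  by apply: (mode_span_lowest spanned (conj sW oW) Wl).
have [|//|NW0|NWE] := Wmin (N' `&` W).
- split=> [|a w [N'w Ww]]; first exact: subspaceI.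
  split; last exact: oW.
  by apply: (subspace_fsum sN') => p; exact: YN'.
- left; apply/seteqP; split; last by move=> _ ->; exact: subspace_0.
  apply: (weak_submodule_lowest spanned no_higher) => //.
    split=> [|a m _ ->]; first exact: subspace_set0.
    exact: (linear_0 (modes_linear_vector _ _)).
  by move=> v lv; rewrite -NW0; split; [exact: lv.1|exact: N'lW].
- right; apply/seteqP; split=> //; apply: (mode_span_sub wN').
  by rewrite -NWE => x [].
Qed.

(** omega has weight 2, so L(0) preserves the degrees of the given grading,
    which may differ from the grading by weights. *)
Lemma components_L0 (u : M) n :
  components (@am_gr R V M) (L0 u) n = L0 (components (@am_gr R V M) u n).
Proof.
have Ll : linear L0 by exact: L0_linear.
have dM := am_grading M.
apply: (linear_ext dM (f := fun u => components (@am_gr R V M) (L0 u) n)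
          (g := fun u => L0 (components (@am_gr R V M) u n))).
- by move=> c v w; rewrite Ll components_linear.
- by move=> c v w; rewrite components_linear // Ll.
move=> m v mv; have mLv : am_gr m (L0 v).
  have := am_graded_action (wt_omega (V := V)) 1 mv.
  by rewrite (_ : 2 + m%:Z - 1 - 1 = m); last lia.
rewrite (components_homogeneous dM mLv) (components_homogeneous dM mv).
by case: eqP => // _; rewrite (linear_0 Ll).
Qed.

Lemma components_lowest (u : M) n :
  lowest u -> lowest (components (@am_gr R V M) u n).
Proof.
have dM := am_grading M.
move=> /lowestE[k uk]; apply/lowestE; exists k.
suff <- : components (@am_gr R V M) (shifts L0 (nseq k lambda) u) n
    = shifts L0 (nseq k lambda) (components (@am_gr R V M) u n).
  by rewrite uk (linear_0 (components_linear dM n)).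
elim: k {uk} => //= k <-; rewrite /shift.
rewrite (linear_B (components_linear dM n)) components_L0.
by rewrite (linear_Z (components_linear dM n)).
Qed.

Lemma completely_reducible_of_lowest :
  semisimple_algebra (@zhu_mul R V) -> completely_reducible M.
Proof.
move=> ssA; apply: (direct_sum_of_simples (sub := @admissible_submodule R V M)).
- by move=> X [].
- exact: admissible_submoduleI.
- exact: admissible_submodule_sum.
set F := simple_sub _; have wF : weak_submodule (span (\bigcup_(N in F) N)).
  by apply/admissible_submodule_weak/admissible_submodule_sum => N [].
suff lF : [set: M] `&` lowest `<=` span (\bigcup_(N in F) N).
  by move=> v; apply: (weak_submodule_lowest spanned no_higher wF _ lF).
move=> u [_ lu]; have [_ _ ->] := componentsP (am_grading M) u.
apply: (subspace_fsum wF.1) => n.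
pose U := lowest `&` @am_gr R V M n.
have [sl ol] := zero_mode_lowest M lambda.
have oU : zero_mode_stable U.
  split; first exact: (subspaceI sl ((am_grading M).1 n)).
  move=> a w [lw nw]; split; first exact: ol.
  apply: (subspace_fsum ((am_grading M).1 n)) => p.
  have := am_graded_action (components_in (voa_grading V) a p) (p - 1) nw.
  by rewrite (_ : p + n%:Z - (p - 1) - 1 = n); last lia.
have Using : U `<=` singular by move=> w [lw _]; exact: lowest_singular lw.
have Uu : U (components (@am_gr R V M) u n).
  by split; [exact: components_lowest|exact: components_in (am_grading M) _ _].
apply: (singular_completely_reducible ssA oU Using Uu wF.1).
move=> w [W [WU Wmin] Ww]; apply: sub_span; exists (mode_span W).
  by apply: (mode_span_irreducible (n := n)) => // x /WU[].
exact: sub_mode_span.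
Qed.

End CompleteReducibility.

Theorem proposition3p5 (R : realType) (V : vertex_operator_algebra R)
    (lambda : R[i]) :
  semisimple_algebra (@zhu_mul R V) ->
  lowest_weights V lambda ->
  [set lambda + (n%:R : R[i]) | n in [set n : nat | (0 < n)%N]]
    `&` lowest_weights V = set0 ->
  forall M : admissible_module V,
    direct_sum (fun n : nat => generalized_eigenspace M (lambda + n%:R)) ->
    completely_reducible M.
Proof.
move=> ssA _ no_higher M dM.
apply: completely_reducible_of_lowest ssA => [v|n n0 Pn].
  apply: (direct_sum_ind dM (W := [set v | exists2 s, _ & shifts _ s v = 0])).
    exact/subspace_shifts_kernel/L0_linear.
  move=> n u /lowestE[k uk]; exists (nseq k (lambda + n%:R)) => // c.
  by rewrite mem_nseq => /andP[_ /eqP ->]; exists n.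
have : set0 (lambda + n%:R) by rewrite -no_higher; split=> //; exists n.
by [].
Qed.
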